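(* Let $H$ be a finite dimensional coFrobenius commutative Hopf algebra over a field $k$, let $\mathcal{M}^H$ be the category of right $H$-comodules and $\mathcal{M}_{H^\ast}$ the category of left $H^\ast$-modules, each with its stable model structure. Let $A$ be a right $H$-comodule algebra, regarded also as an algebra in $\mathcal{M}_{H^\ast}$. Let $i:\mathcal{M}^H\to\mathcal{M}_{H^\ast}$ be the inclusion functor and $\tilde{i}:\mathrm{LMod}_A(\mathcal{M}^H)\to\mathrm{LMod}_A(\mathcal{M}_{H^\ast})$ the induced functor on left $A$-modules. Then, denoting by $U$ both forgetful functors $\mathrm{LMod}_A(\mathcal{M}^H)\to\mathcal{M}^H$ and $\mathrm{LMod}_A(\mathcal{M}_{H^\ast})\to\mathcal{M}_{H^\ast}$, the square of functors commutes: $$U\circ\tilde{i}=i\circ U:\mathrm{LMod}_A(\mathcal{M}^H)\to\mathcal{M}_{H^\ast}.$$ Assume moreover that $\mathrm{LMod}_A(\mathcal{M}_{H^\ast})$ carries the model structure in which weak equivalences and fibrations are the maps sent by $U$ to weak equivalences and fibrations of $\mathcal{M}_{H^\ast}$, and cofibrations are the maps with the left lifting property with respect to trivial fibrations. Equip $\mathrm{LMod}_A(\mathcal{M}^H)$ with the model structure in which weak equivalences and fibrations are the maps sent by $U$ to weak equivalences and fibrations of $\mathcal{M}^H$, and cofibrations are the maps with the left lifting property with respect to trivial fibrations. Then $i$ and $\tilde{i}$ are both left and right Quillen functors, and the two forgetful functors $U$ are right Quillen functors.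
   Context: $\otimes=\otimes_k$. A Hopf algebra $H$ over $k$ is coFrobenius if there is a nonzero $k$-linear map $\Lambda:H\to k$ with $h_{(1)}\Lambda(h_{(2)})=\Lambda(h)1$ for all $h\in H$. $H^\ast=\mathrm{Hom}_k(H,k)$ with its dual Hopf algebra structure (convolution product, coproduct dual to the product of $H$). The inclusion $i$ sends a right $H$-comodule $M$ to the left $H^\ast$-module $M$ with action $x\cdot m=x(m_{(1)})m_{(0)}$. Tensor products in $\mathcal{M}^H$ carry the diagonal coaction, and in $\mathcal{M}_{H^\ast}$ the diagonal action. A right $H$-comodule algebra is a $k$-algebra with a right $H$-comodule structure for which multiplication and unit are $H$-colinear. For $\mathcal{C}=\mathcal{M}^H$ or $\mathcal{M}_{H^\ast}$, $\mathrm{LMod}_A(\mathcal{C})$ is the category of left $A$-module objects in $\mathcal{C}$, with morphisms the maps of $\mathcal{C}$ that are $A$-linear; thus $\mathrm{LMod}_A(\mathcal{M}_{H^\ast})$ is the category of modules over the smash product $A\# H^\ast$. Both $\mathcal{M}^H$ and $\mathcal{M}_{H^\ast}$ are abelian Frobenius categories. The stable model structure on such a category has cofibrations the monomorphisms, fibrations the epimorphisms, and weak equivalences the stable equivalences, i.e. the maps that become isomorphisms in the quotient category obtained by identifying two parallel maps whose difference factors through an injective object. *)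

(* Defs.v *)
From HB Require Import structures.
From mathcomp Require Import all_boot all_order all_algebra all_field.
From mathcomp Require Import boolp.

Set Implicit Arguments.
Unset Strict Implicit.
Unset Printing Implicit Defensive.

Import GRing.Theory.
Local Open Scope ring_scope.
Local Open Scope quotient_scope.

Definition is_bilinear (k : fieldType) (V W U : lmodType k) (b : V -> W -> U) :=
  (forall w, linear (b^~ w)) /\ (forall v, linear (b v)).

(* The tensor product of two (arbitrary) k-vector spaces: a formal sum        *)
(* sum_i v_i (x) w_i is a sequence of pairs, and two of them are identified   *)
(* when no bilinear map separates them.                                       *)
Section Tensor.
Variables (k : fieldType) (V W : lmodType k).

Definition tensor_rel (s t : seq (V * W)) : bool :=
  `[< forall (U : lmodType k) (b : V -> W -> U), is_bilinear b ->
        \sum_(p <- s) b p.1 p.2 = \sum_(p <- t) b p.1 p.2 >].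

Lemma tensor_rel_refl : reflexive tensor_rel.
Proof. by move=> s; apply/asboolP. Qed.

Lemma tensor_rel_sym : symmetric tensor_rel.
Proof. by move=> s t; apply/asboolP/asboolP => e U b /e. Qed.

Lemma tensor_rel_trans : transitive tensor_rel.
Proof.
move=> t s u /asboolP e1 /asboolP e2; apply/asboolP => U b bb.
by rewrite e1 // e2.
Qed.

Canonical tensor_equiv :=
  EquivRel tensor_rel tensor_rel_refl tensor_rel_sym tensor_rel_trans.

Definition tensor := {eq_quot tensor_equiv}.
HB.instance Definition _ := Choice.on tensor.
HB.instance Definition _ := EqQuotient.on tensor.

(* tsum b t = sum_i b v_i w_i for t = sum_i v_i (x) w_i; when b is bilinear   *)
(* this is the value at t of the linear map on the tensor product induced     *)
(* by b (lemmas tsum_tens and tsum_linear).                                   *)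
Definition tsum (U : nmodType) (b : V -> W -> U) (t : tensor) : U :=
  \sum_(p <- repr t) b p.1 p.2.

Definition tens (v : V) (w : W) : tensor := \pi_tensor [:: (v, w)].

Lemma tsum_pi (U : lmodType k) (b : V -> W -> U) s : is_bilinear b ->
  tsum b (\pi_tensor s) = \sum_(p <- s) b p.1 p.2.
Proof.
move=> bb; have : repr (\pi_tensor s) = s %[mod tensor] by rewrite reprK.
by move/eqmodP/asboolP; apply.
Qed.

Lemma tensor_eqP (t u : tensor) :
  (forall (U : lmodType k) (b : V -> W -> U), is_bilinear b ->
     tsum b t = tsum b u) -> t = u.
Proof.
move=> e; rewrite -[t]reprK -[u]reprK; apply/eqmodP/asboolP => U b bb.
exact: e.
Qed.

Definition tensor_zero : tensor := \pi_tensor [::].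
Definition tensor_add (t u : tensor) : tensor :=
  \pi_tensor (repr t ++ repr u).
Definition tensor_scale (c : k) (t : tensor) : tensor :=
  \pi_tensor [seq (c *: p.1, p.2) | p <- repr t].
Definition tensor_opp (t : tensor) : tensor := tensor_scale (-1) t.

Section Ops.
Variables (U : lmodType k) (b : V -> W -> U).
Hypothesis bb : is_bilinear b.

Lemma tsum0_subproof : tsum b tensor_zero = 0.
Proof. by rewrite tsum_pi // big_nil. Qed.

Lemma tsumD_subproof t u : tsum b (tensor_add t u) = tsum b t + tsum b u.
Proof. by rewrite tsum_pi // big_cat. Qed.

Lemma tsumZ_subproof c t : tsum b (tensor_scale c t) = c *: tsum b t.
Proof.
rewrite tsum_pi // big_map /tsum scaler_sumr; apply: eq_bigr => p _ /=.
have [bl _] := bb.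
have b0 : b 0 p.2 = 0.
  by have := bl p.2 (-1) 0 0; rewrite scaler0 addr0 scaleN1r addNr.
by have := bl p.2 c p.1 0; rewrite /= b0 !addr0.
Qed.
End Ops.

Let tE := (tsum0_subproof, tsumD_subproof, tsumZ_subproof).

Lemma tensor_addA : associative tensor_add.
Proof. by move=> t u v; apply: tensor_eqP => U b bb; rewrite !tE // addrA. Qed.
Lemma tensor_addC : commutative tensor_add.
Proof. by move=> t u; apply: tensor_eqP => U b bb; rewrite !tE // addrC. Qed.
Lemma tensor_add0 : left_id tensor_zero tensor_add.
Proof. by move=> t; apply: tensor_eqP => U b bb; rewrite !tE // add0r. Qed.
Lemma tensor_addN : left_inverse tensor_zero tensor_opp tensor_add.
Proof.
move=> t; apply: tensor_eqP => U b bb.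
by rewrite /tensor_opp !tE // scaleN1r addNr.
Qed.

HB.instance Definition _ :=
  GRing.isZmodule.Build tensor tensor_addA tensor_addC tensor_add0 tensor_addN.

Lemma tensor_scaleA c d t :
  tensor_scale c (tensor_scale d t) = tensor_scale (c * d) t.
Proof. by apply: tensor_eqP => U b bb; rewrite !tE // scalerA. Qed.
Lemma tensor_scale1 : left_id 1 tensor_scale.
Proof. by move=> t; apply: tensor_eqP => U b bb; rewrite !tE // scale1r. Qed.
Lemma tensor_scaleDr : right_distributive tensor_scale +%R.
Proof.
by move=> c t u; apply: tensor_eqP => U b bb; rewrite !tE // scalerDr.
Qed.
Lemma tensor_scaleDl t : {morph tensor_scale^~ t : c d / c + d}.
Proof.
by move=> c d; apply: tensor_eqP => U b bb; rewrite !tE // scalerDl.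
Qed.

HB.instance Definition _ := GRing.Zmodule_isLmodule.Build k tensor
  tensor_scaleA tensor_scale1 tensor_scaleDr tensor_scaleDl.

Lemma tsum_linear (U : lmodType k) (b : V -> W -> U) :
  is_bilinear b -> linear (tsum b).
Proof. by move=> bb c t u; rewrite !tE. Qed.

Lemma tsum_tens (U : lmodType k) (b : V -> W -> U) v w :
  is_bilinear b -> tsum b (tens v w) = b v w.
Proof. by move=> bb; rewrite tsum_pi // big_seq1. Qed.

Lemma tens_bilinear : is_bilinear tens.
Proof.
split=> [w c v v'|v c w w']; apply: tensor_eqP => U b bb; have [bl br] := bb;
  by rewrite /= tsum_linear // !tsum_tens //; (exact: bl || exact: br).
Qed.

Lemma tsum_tensE (t : tensor) : tsum tens t = t.
Proof.
apply: tensor_eqP => U b bb.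
rewrite [in LHS](_ : tsum tens t = \sum_(p <- repr t) tens p.1 p.2) //.
have H : {morph tsum b : x y / x + y}.
  by move=> x y; rewrite -[x]scale1r (tsum_linear bb) !scale1r.
have H0 : tsum b 0 = 0 := tsum0_subproof bb.
rewrite (big_morph _ H H0).
by apply: eq_bigr => p _; rewrite tsum_tens.
Qed.

End Tensor.

Notation "v ⊗ w" := (tens v w) (at level 40, left associativity).
Notation "\tsum_ ( x , y <- t ) E" := (tsum (fun x y => E) t)
  (at level 41, E at level 41, x name, y name,
   format "\tsum_ ( x ,  y  <-  t )  E").

(* Sums \tsum_(a, b <- comul h) E are Sweedler's notation h_(1), h_(2). A     *)
(* falgType is a finite-dimensional algebra, so H is finite-dimensional.      *)
Record hopfAlgebra (k : fieldType) := HopfAlgebra {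
  hopf_sort :> falgType k;
  comul : hopf_sort -> tensor hopf_sort hopf_sort;
  counit : hopf_sort -> k;
  antipode : hopf_sort -> hopf_sort;
  comul_linear : linear comul;
  counit_linear : scalar counit;
  antipode_linear : linear antipode;
  comulA : forall h,
    \tsum_(a, b <- comul h) \tsum_(a1, a2 <- comul a) a1 ⊗ (a2 ⊗ b)
      = \tsum_(a, b <- comul h) \tsum_(b1, b2 <- comul b) a ⊗ (b1 ⊗ b2);
  counit_comull : forall h, \tsum_(a, b <- comul h) counit a *: b = h;
  counit_comulr : forall h, \tsum_(a, b <- comul h) counit b *: a = h;
  comulM : forall g h, comul (g * h) =
    \tsum_(a, b <- comul g) \tsum_(c, d <- comul h) (a * c) ⊗ (b * d);
  comul1 : comul 1 = 1 ⊗ 1;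
  counitM : forall g h, counit (g * h) = counit g * counit h;
  counit1 : counit 1 = 1;
  antipode_comull : forall h,
    \tsum_(a, b <- comul h) antipode a * b = counit h *: 1;
  antipode_comulr : forall h,
    \tsum_(a, b <- comul h) a * antipode b = counit h *: 1
}.

Definition cofrobenius (k : fieldType) (H : hopfAlgebra k) : Prop :=
  exists L : H -> k,
    [/\ scalar L,
        exists h, L h != 0
      & forall h, \tsum_(a, b <- comul h) L b *: a = L h *: 1].

Section Dual.
Variables (k : fieldType) (H : hopfAlgebra k).

Definition hdual := 'Hom(H, k^o).
HB.instance Definition _ := Vector.on hdual.

Definition dual_mul (x y : hdual) : hdual :=
  linfun (fun h : H => (\tsum_(a, b <- comul h) (x a *: y b) : k^o)).

Definition dual_one : hdual := linfun (@counit k H : H -> k^o).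

(* The coproduct of H^*, i.e. the element sum_i y_i (x) z_i of H^* (x) H^*    *)
(* with x (g * h) = sum_i y_i g * z_i h for all g and h (lemma dual_comulE),  *)
(* written in the basis dual to a basis of H.                                 *)
Definition dual_comul (x : hdual) : tensor hdual hdual :=
  let e := vbasis {:H} in
  let e_ i : hdual := linfun (coord e i : H -> k^o) in
  \sum_(i < \dim {:H}) \sum_(j < \dim {:H})
    (x (e`_i * e`_j) : k) *: (e_ i ⊗ e_ j).

Definition dual_counit (x : hdual) : k := x 1.

End Dual.

Record category := Category {
  obj : Type;
  hom : obj -> obj -> Type;
  idm : forall X, hom X X;
  comp : forall X Y Z, hom Y Z -> hom X Y -> hom X Z;
  comp1m : forall X Y (f : hom X Y), comp (idm Y) f = f;
  compm1 : forall X Y (f : hom X Y), comp f (idm X) = f;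
  compA : forall X Y Z T (h : hom Z T) (g : hom Y Z) (f : hom X Y),
    comp h (comp g f) = comp (comp h g) f
}.

Notation "g \c f" := (comp g f) (at level 40, left associativity).

Record preadditive := Preadditive {
  pobj : Type;
  phom : pobj -> pobj -> zmodType;
  pidm : forall X, phom X X;
  pcomp : forall X Y Z, phom Y Z -> phom X Y -> phom X Z;
  pcomp1m : forall X Y (f : phom X Y), pcomp (pidm Y) f = f;
  pcompm1 : forall X Y (f : phom X Y), pcomp f (pidm X) = f;
  pcompA : forall X Y Z T (h : phom Z T) (g : phom Y Z) (f : phom X Y),
    pcomp h (pcomp g f) = pcomp (pcomp h g) f;
  pcompDl : forall X Y Z (g g' : phom Y Z) (f : phom X Y),
    pcomp (g + g') f = pcomp g f + pcomp g' f;
  pcompDr : forall X Y Z (g : phom Y Z) (f f' : phom X Y),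
    pcomp g (f + f') = pcomp g f + pcomp g f'
}.

Definition cat_of_preadditive (C : preadditive) : category :=
  @Category (pobj C) (fun X Y => phom X Y) (@pidm C) (@pcomp C)
    (@pcomp1m C) (@pcompm1 C) (@pcompA C).
Coercion cat_of_preadditive : preadditive >-> category.

Record functor (C D : category) := Functor {
  fobj :> obj C -> obj D;
  fmap : forall X Y, hom X Y -> hom (fobj X) (fobj Y);
  fmap1 : forall X, fmap (idm X) = idm (fobj X);
  fmap_comp : forall X Y Z (g : hom Y Z) (f : hom X Y),
    fmap (g \c f) = fmap g \c fmap f
}.

Section FunctorComp.
Variables (C D E : category) (G : functor D E) (F : functor C D).

Lemma functor_comp1 X : fmap G (fmap F (idm X)) = idm (G (F X)).
Proof. by rewrite !fmap1. Qed.

Lemma functor_compM X Y Z (g : hom Y Z) (f : hom X Y) :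
  fmap G (fmap F (g \c f)) = fmap G (fmap F g) \c fmap G (fmap F f).
Proof. by rewrite !fmap_comp. Qed.

Definition functor_comp : functor C E :=
  @Functor C E (fun X => G (F X)) (fun X Y f => fmap G (fmap F f))
    functor_comp1 functor_compM.
End FunctorComp.

Record adjunction (C D : category) (F : functor C D) (G : functor D C) :=
  Adjunction {
    adj_unit : forall X, hom X (G (F X));
    adj_counit : forall Y, hom (F (G Y)) Y;
    adj_unit_nat : forall X X' (f : hom X X'),
      adj_unit X' \c f = fmap G (fmap F f) \c adj_unit X;
    adj_counit_nat : forall Y Y' (g : hom Y Y'),
      adj_counit Y' \c fmap F (fmap G g) = g \c adj_counit Y;
    adj_triangle_l : forall X,
      adj_counit (F X) \c fmap F (adj_unit X) = idm (F X);
    adj_triangle_r : forall Y,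
      fmap G (adj_counit Y) \c adj_unit (G Y) = idm (G Y)
  }.

Section Morphisms.
Variable C : category.

Definition mono (X Y : obj C) (f : hom X Y) : Prop :=
  forall Z (g h : hom Z X), f \c g = f \c h -> g = h.

Definition epi (X Y : obj C) (f : hom X Y) : Prop :=
  forall Z (g h : hom Y Z), g \c f = h \c f -> g = h.

Definition injective_obj (I : obj C) : Prop :=
  forall (X Y : obj C) (f : hom X Y) (g : hom X I),
    mono f -> exists h : hom Y I, h \c f = g.

Definition retract (X Y X' Y' : obj C) (f : hom X Y) (g : hom X' Y') : Prop :=
  exists (i : hom X X') (r : hom X' X) (j : hom Y Y') (s : hom Y' Y),
    [/\ r \c i = idm X, s \c j = idm Y, g \c i = j \c f & f \c r = s \c g].

Definition has_lift (A B X Y : obj C) (i : hom A B) (p : hom X Y) : Prop :=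
  forall (u : hom A X) (v : hom B Y), p \c u = v \c i ->
    exists h : hom B X, h \c i = u /\ p \c h = v.
End Morphisms.

Record model_classes (C : category) := ModelClasses {
  weq : forall X Y : obj C, hom X Y -> Prop;
  cof : forall X Y : obj C, hom X Y -> Prop;
  fib : forall X Y : obj C, hom X Y -> Prop
}.

(* A model structure is three subcategories closed under retracts, with 2-out-*)
(* of-3, lifting and (not necessarily functorial) factorizations; limits and  *)
(* colimits are a property of the underlying category, not part of it.        *)
Section Model.
Variables (C : category) (M : model_classes C).

Definition trivial_cof (X Y : obj C) (f : hom X Y) := cof M f /\ weq M f.
Definition trivial_fib (X Y : obj C) (f : hom X Y) := fib M f /\ weq M f.

Definition subcategory (P : forall X Y : obj C, hom X Y -> Prop) : Prop :=
  (forall X, P _ _ (idm X)) /\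
  (forall X Y Z (g : hom Y Z) (f : hom X Y),
     P _ _ g -> P _ _ f -> P _ _ (g \c f)).

Definition retract_closed (P : forall X Y : obj C, hom X Y -> Prop) : Prop :=
  forall X Y X' Y' (f : hom X Y) (g : hom X' Y'),
    retract f g -> P _ _ g -> P _ _ f.

Definition two_of_three (P : forall X Y : obj C, hom X Y -> Prop) : Prop :=
  forall X Y Z (g : hom Y Z) (f : hom X Y),
    [/\ P _ _ f -> P _ _ g -> P _ _ (g \c f),
        P _ _ f -> P _ _ (g \c f) -> P _ _ g
      & P _ _ g -> P _ _ (g \c f) -> P _ _ f].

Record is_model_structure : Prop := IsModelStructure {
  model_subcat : [/\ subcategory (@weq C M), subcategory (@cof C M)
                   & subcategory (@fib C M)];
  model_two_of_three : two_of_three (@weq C M);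
  model_retract : [/\ retract_closed (@weq C M), retract_closed (@cof C M)
                    & retract_closed (@fib C M)];
  model_lift_tcof : forall A B X Y (i : hom A B) (p : hom X Y),
    trivial_cof i -> fib M p -> has_lift i p;
  model_lift_tfib : forall A B X Y (i : hom A B) (p : hom X Y),
    cof M i -> trivial_fib p -> has_lift i p;
  model_factor_tcof : forall X Y (f : hom X Y),
    exists Z (p : hom Z Y) (i : hom X Z),
      [/\ trivial_cof i, fib M p & p \c i = f];
  model_factor_tfib : forall X Y (f : hom X Y),
    exists Z (p : hom Z Y) (i : hom X Z),
      [/\ cof M i, trivial_fib p & p \c i = f]
}.
End Model.

Section Quillen.
Variables (C D : category) (MC : model_classes C) (MD : model_classes D).

Definition left_quillen (F : functor C D) : Prop :=
  [/\ exists G : functor D C, inhabited (adjunction F G),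
      forall X Y (f : hom X Y), cof MC f -> cof MD (fmap F f)
    & forall X Y (f : hom X Y),
        trivial_cof MC f -> trivial_cof MD (fmap F f)].

Definition right_quillen (F : functor C D) : Prop :=
  [/\ exists G : functor D C, inhabited (adjunction G F),
      forall X Y (f : hom X Y), fib MC f -> fib MD (fmap F f)
    & forall X Y (f : hom X Y),
        trivial_fib MC f -> trivial_fib MD (fmap F f)].

Definition right_induced (U : functor C D) : model_classes C :=
  let we X Y (f : hom X Y) := weq MD (fmap U f) in
  let fi X Y (f : hom X Y) := fib MD (fmap U f) in
  ModelClasses we
    (fun A B i => forall X Y (p : hom X Y),
       fi _ _ p /\ we _ _ p -> has_lift i p)
    fi.
End Quillen.

Section Stable.
Variable C : preadditive.

Definition factors_injective (X Y : obj C) (f : hom X Y) : Prop :=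
  exists (I : obj C) (v : hom I Y) (u : hom X I),
    injective_obj I /\ f = v \c u.

(* The stable category has the objects of C and the classes of this relation  *)
(* as morphisms; when C has binary biproducts the relation is a congruence.   *)
Definition stably_equal (X Y : pobj C) (f g : phom X Y) : Prop :=
  @factors_injective X Y (f - g).

(* The class of f is an isomorphism of the stable category. *)
Definition stable_equivalence (X Y : obj C) (f : hom X Y) : Prop :=
  exists g : hom Y X,
    stably_equal (g \c f) (idm X) /\ stably_equal (f \c g) (idm Y).

Definition stable_model : model_classes C :=
  ModelClasses stable_equivalence (@mono C) (@epi C).
End Stable.

(* Categories of k-vector spaces with extra structure: the morphisms are the  *)
(* linear maps satisfying lin_pres.                                           *)
Record linear_data (k : fieldType) := LinearData {
  lin_obj : Type;
  lin_car : lin_obj -> lmodType k;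
  lin_pres : forall X Y, (lin_car X -> lin_car Y) -> Prop;
  lin_pres_id : forall X, @lin_pres X X id;
  lin_pres_comp : forall X Y Z (g : lin_car Y -> lin_car Z)
      (f : lin_car X -> lin_car Y),
    linear g -> linear f -> lin_pres g -> lin_pres f -> lin_pres (g \o f);
  lin_pres0 : forall X Y, @lin_pres X Y (fun=> 0);
  lin_presB : forall X Y (f g : lin_car X -> lin_car Y),
    linear f -> linear g -> lin_pres f -> lin_pres g ->
    lin_pres (fun x => f x - g x)
}.

Section LinearCat.
Variables (k : fieldType) (C : linear_data k).
Implicit Types X Y Z : lin_obj C.

Definition lin_hom X Y : Type :=
  {f : lin_car X -> lin_car Y | linear f /\ lin_pres f}.

HB.instance Definition _ X Y := gen_eqMixin (lin_hom X Y).
HB.instance Definition _ X Y := gen_choiceMixin (lin_hom X Y).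

Lemma lin_homP X Y (f g : lin_hom X Y) : sval f =1 sval g -> f = g.
Proof. by case: f g => f Pf [g Pg] /= /funext; apply: eq_exist. Qed.

Lemma lin_hom0_subproof X Y :
  linear ((fun=> 0) : lin_car X -> lin_car Y) /\ @lin_pres _ C X Y (fun=> 0).
Proof.
by split; [move=> c x y; rewrite scaler0 addr0 | exact: lin_pres0].
Qed.
Definition lin_hom0 X Y : lin_hom X Y :=
  exist _ (fun=> 0) (lin_hom0_subproof X Y).

Lemma lin_homB_subproof X Y (f g : lin_hom X Y) :
  linear (fun x => sval f x - sval g x) /\
  lin_pres (fun x => sval f x - sval g x).
Proof.
case: f g => f [lf pf] [g [lg pg]] /=; split; last exact: lin_presB.
by move=> c x y; rewrite lf lg scalerBr opprD addrACA.
Qed.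

Lemma lin_homN_subproof X Y (f : lin_hom X Y) :
  linear (fun x => - sval f x) /\ lin_pres (fun x => - sval f x).
Proof.
have := lin_homB_subproof (lin_hom0 X Y) f.
by under [fun x => _ - _]funext do rewrite sub0r.
Qed.
Definition lin_homN X Y (f : lin_hom X Y) : lin_hom X Y :=
  exist _ (fun x => - sval f x) (lin_homN_subproof f).

Lemma lin_homD_subproof X Y (f g : lin_hom X Y) :
  linear (fun x => sval f x + sval g x) /\
  lin_pres (fun x => sval f x + sval g x).
Proof.
have := lin_homB_subproof f (lin_homN g).
by under [fun x => _ - _]funext do rewrite opprK.
Qed.
Definition lin_homD X Y (f g : lin_hom X Y) : lin_hom X Y :=
  exist _ (fun x => sval f x + sval g x) (lin_homD_subproof f g).

Lemma lin_hom_addA X Y : associative (@lin_homD X Y).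
Proof. by move=> f g h; apply: lin_homP => x /=; rewrite addrA. Qed.
Lemma lin_hom_addC X Y : commutative (@lin_homD X Y).
Proof. by move=> f g; apply: lin_homP => x /=; rewrite addrC. Qed.
Lemma lin_hom_add0 X Y : left_id (lin_hom0 X Y) (@lin_homD X Y).
Proof. by move=> f; apply: lin_homP => x /=; rewrite add0r. Qed.
Lemma lin_hom_addN X Y :
  left_inverse (lin_hom0 X Y) (@lin_homN X Y) (@lin_homD X Y).
Proof. by move=> f; apply: lin_homP => x /=; rewrite addNr. Qed.

HB.instance Definition _ X Y := GRing.isZmodule.Build (lin_hom X Y)
  (@lin_hom_addA X Y) (@lin_hom_addC X Y) (@lin_hom_add0 X Y)
  (@lin_hom_addN X Y).

Lemma lin_id_subproof X : 
  linear (id : lin_car X -> lin_car X) /\ @lin_pres _ C X X id.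
Proof. by split=> //; exact: lin_pres_id. Qed.
Definition lin_id X : lin_hom X X := exist _ id (lin_id_subproof X).

Lemma lin_comp_subproof X Y Z (g : lin_hom Y Z) (f : lin_hom X Y) :
  linear (sval g \o sval f) /\ lin_pres (sval g \o sval f).
Proof.
case: f g => f [lf pf] [g [lg pg]] /=; split; last exact: lin_pres_comp.
by move=> c x y /=; rewrite lf lg.
Qed.
Definition lin_comp X Y Z (g : lin_hom Y Z) (f : lin_hom X Y) : lin_hom X Z :=
  exist _ (sval g \o sval f) (lin_comp_subproof g f).

Lemma lin_comp1m X Y (f : lin_hom X Y) : lin_comp (lin_id Y) f = f.
Proof. exact: lin_homP. Qed.
Lemma lin_compm1 X Y (f : lin_hom X Y) : lin_comp f (lin_id X) = f.
Proof. exact: lin_homP. Qed.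
Lemma lin_compA X Y Z T (h : lin_hom Z T) (g : lin_hom Y Z) (f : lin_hom X Y) :
  lin_comp h (lin_comp g f) = lin_comp (lin_comp h g) f.
Proof. exact: lin_homP. Qed.
Lemma lin_compDl X Y Z (g g' : lin_hom Y Z) (f : lin_hom X Y) :
  lin_comp (g + g') f = lin_comp g f + lin_comp g' f.
Proof. exact: lin_homP. Qed.
Lemma lin_compDr X Y Z (g : lin_hom Y Z) (f f' : lin_hom X Y) :
  lin_comp g (f + f') = lin_comp g f + lin_comp g f'.
Proof.
apply: lin_homP => x; case: g => g [lg pg] /=.
by rewrite -[sval f x]scale1r lg !scale1r.
Qed.

Definition lin_cat : preadditive :=
  @Preadditive (lin_obj C) (fun X Y => lin_hom X Y : zmodType) lin_id lin_comp
    lin_comp1m lin_compm1 lin_compA lin_compDl lin_compDr.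
End LinearCat.

Lemma linear_map0 (k : fieldType) (V W : lmodType k) (f : V -> W) :
  linear f -> f 0 = 0.
Proof. by move=> /(_ (-1) 0 0); rewrite scaler0 addr0 scaleN1r addNr. Qed.

Lemma linear_mapD (k : fieldType) (V W : lmodType k) (f : V -> W) :
  linear f -> {morph f : x y / x + y}.
Proof. by move=> lf x y; rewrite -[x]scale1r lf !scale1r. Qed.

Lemma linear_mapZ (k : fieldType) (V W : lmodType k) (f : V -> W) c :
  linear f -> {morph f : x / c *: x}.
Proof. by move=> lf x; rewrite -[c *: x]addr0 lf linear_map0 // addr0. Qed.

Lemma linear_map_sum (k : fieldType) (V W : lmodType k) (f : V -> W)
    I (r : seq I) (P : pred I) (F : I -> V) : linear f ->
  f (\sum_(i <- r | P i) F i) = \sum_(i <- r | P i) f (F i).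
Proof.
by move=> lf; apply: big_morph; [exact: linear_mapD | exact: linear_map0].
Qed.

Lemma linear_tsum (k : fieldType) (V W U U' : lmodType k) (f : U -> U')
    (b : V -> W -> U) t : linear f ->
  f (\tsum_(v, w <- t) b v w) = \tsum_(v, w <- t) f (b v w).
Proof. exact: linear_map_sum. Qed.

Lemma scaler_tsuml (k : fieldType) (V W U : lmodType k)
    (b : V -> W -> k^o) t (u : U) :
  ((\tsum_(v, w <- t) b v w) : k) *: u = \tsum_(v, w <- t) (b v w : k) *: u.
Proof. exact: scaler_suml. Qed.

Lemma scaler_tsumr (k : fieldType) (V W U : lmodType k)
    (b : V -> W -> U) t (c : k) :
  c *: (\tsum_(v, w <- t) b v w) = \tsum_(v, w <- t) c *: b v w.
Proof. exact: scaler_sumr. Qed.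

Lemma eq_tsum (k : fieldType) (V W : lmodType k) (U : nmodType)
    (b c : V -> W -> U) t : b =2 c ->
  \tsum_(v, w <- t) b v w = \tsum_(v, w <- t) c v w.
Proof. by move=> e; apply: eq_bigr => p _. Qed.

Lemma exchange_tsum (k : fieldType) (V W V' W' : lmodType k) (U : nmodType)
    (b : V -> W -> V' -> W' -> U) t t' :
  \tsum_(v, w <- t) \tsum_(v', w' <- t') b v w v' w'
    = \tsum_(v', w' <- t') \tsum_(v, w <- t) b v w v' w'.
Proof. exact: exchange_big. Qed.

Lemma linear_of_tsum (k : fieldType) (V W U X : lmodType k)
    (b : X -> V -> W -> U) t : (forall v w, linear (fun x => b x v w)) ->
  linear (fun x => \tsum_(v, w <- t) b x v w).
Proof.
move=> lb c x y; rewrite /tsum scaler_sumr -big_split.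
by apply: eq_bigr => p _; rewrite lb.
Qed.

Lemma linear_lfun (k : fieldType) (V W : vectType k) (x : 'Hom(V, W)) :
  linear (x : V -> W).
Proof. by move=> c u v; rewrite linearP. Qed.

Lemma lfun_of_linearE (k : fieldType) (V W : vectType k) (f : V -> W) :
  linear f -> linfun f =1 f.
Proof.
move=> lf v.
pose g : {linear V -> W} := HB.pack f (GRing.isLinear.Build k V W *:%R f lf).
by rewrite -[f]/(g : V -> W) lfunE.
Qed.

Section DualTheory.
Variables (k : fieldType) (H : hopfAlgebra k).

Lemma bilinear_form_mul (V W : lmodType k) (f : V -> k^o) (g : W -> k^o) :
  linear f -> linear g ->
  is_bilinear ((fun v w => (f v : k) * g w) : V -> W -> k^o).
Proof.
move=> lf lg; split=> [w c u v | v c u w]; rewrite /= ?lf ?lg.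
  by rewrite mulrDl -[c *: f u]/(c * f u) -mulrA.
by rewrite mulrDr -[c *: g u]/(c * g u) mulrCA.
Qed.

Lemma dual_mulE (x y : hdual H) (h : H) :
  dual_mul x y h = \tsum_(a, b <- comul h) ((x a : k) * y b : k^o).
Proof.
rewrite /dual_mul lfun_of_linearE // => c u v.
have bb : is_bilinear ((fun a b => (x a : k) * y b) : H -> H -> k^o).
  by apply: bilinear_form_mul; exact: linear_lfun.
by rewrite (@comul_linear k H) (tsum_linear bb).
Qed.

Lemma dual_oneE (h : H) : dual_one H h = counit h.
Proof. by rewrite /dual_one lfun_of_linearE //; exact: counit_linear. Qed.

Lemma dual_comulE (x : hdual H) (g h : H) :
  \tsum_(y, z <- dual_comul x)
    (((y : hdual H) g : k) * (z : hdual H) h : k^o) = x (g * h).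
Proof.
have bb : is_bilinear
    ((fun y z : hdual H => (y g : k) * z h) : hdual H -> hdual H -> k^o).
  by apply: bilinear_form_mul => c y z; rewrite /= add_lfunE scale_lfunE.
rewrite /dual_comul (linear_map_sum _ _ _ (tsum_linear bb)).
rewrite {2}(coord_vbasis (memvf g)) {2}(coord_vbasis (memvf h)).
rewrite mulr_suml linear_sum; apply: eq_bigr => i _.
rewrite (linear_map_sum _ _ _ (tsum_linear bb)) mulr_sumr linear_sum.
apply: eq_bigr => j _.
rewrite (linear_mapZ _ (tsum_linear bb)) tsum_tens //.
rewrite -scalerAl -scalerAr !linearZ /= !lfun_of_linearE;
  try exact: linear_lfun.
- by congr (_ *: _); exact: mulrC.
- by move=> c u v; rewrite linearP.
- by move=> c u v; rewrite linearP.
Qed.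
End DualTheory.

Definition is_coaction (k : fieldType) (H : hopfAlgebra k) (M : lmodType k)
    (r : M -> tensor M H) : Prop :=
  [/\ linear r,
      forall m,
        \tsum_(m0, m1 <- r m) \tsum_(m00, m01 <- r (m0 : M)) m00 ⊗ (m01 ⊗ m1)
        = \tsum_(m0, m1 <- r m) \tsum_(h1, h2 <- comul m1) m0 ⊗ (h1 ⊗ h2)
    & forall m, \tsum_(m0, m1 <- r m) counit m1 *: m0 = m].

Record comodule (k : fieldType) (H : hopfAlgebra k) := Comodule {
  comod_car :> lmodType k;
  coact : comod_car -> tensor comod_car H;
  coactP : is_coaction coact
}.

Definition colinear (k : fieldType) (H : hopfAlgebra k) (M N : comodule H)
    (f : M -> N) : Prop :=
  forall m, coact (f m) = \tsum_(m0, m1 <- coact m) f m0 ⊗ m1.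

(* For a bilinear b, colinearity of the induced map M (x) N -> P, where       *)
(* M (x) N carries the diagonal coaction.                                     *)
Definition colinear2 (k : fieldType) (H : hopfAlgebra k) (M N P : comodule H)
    (b : M -> N -> P) : Prop :=
  forall m n, coact (b m n) =
    \tsum_(m0, m1 <- coact m) \tsum_(n0, n1 <- coact n) b m0 n0 ⊗ (m1 * n1).

Definition is_action (k : fieldType) (H : hopfAlgebra k) (M : lmodType k)
    (act : hdual H -> M -> M) : Prop :=
  [/\ is_bilinear act,
      forall m, act (dual_one H) m = m
    & forall x y m, act (dual_mul x y) m = act x (act y m)].

Record hmodule (k : fieldType) (H : hopfAlgebra k) := HModule {
  hmod_car :> lmodType k;
  hact : hdual H -> hmod_car -> hmod_car;
  hactP : is_action hact
}.

Definition hlinear (k : fieldType) (H : hopfAlgebra k) (M N : hmodule H)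
    (f : M -> N) : Prop :=
  forall x m, f (hact x m) = hact x (f m).

(* For a bilinear b, H^*-linearity of the induced map M (x) N -> P, where     *)
(* M (x) N carries the diagonal action.                                       *)
Definition hlinear2 (k : fieldType) (H : hopfAlgebra k) (M N P : hmodule H)
    (b : M -> N -> P) : Prop :=
  forall x m n, hact x (b m n) =
    \tsum_(y, z <- dual_comul x) b (hact y m) (hact z n).

(* k-algebras; unlike algType, this includes the zero algebra. *)
Record kalgebra (k : fieldType) := KAlgebra {
  alg_car :> lmodType k;
  amul : alg_car -> alg_car -> alg_car;
  aone : alg_car;
  amul_bilinear : is_bilinear amul;
  amulA : associative amul;
  amul1 : left_id aone amul;
  amulr1 : right_id aone amul
}.

Definition is_module (k : fieldType) (A : kalgebra k) (M : lmodType k)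
    (act : A -> M -> M) : Prop :=
  [/\ is_bilinear act,
      forall m, act (aone A) m = m
    & forall a b m, act (amul a b) m = act a (act b m)].

Record comodule_algebra (k : fieldType) (H : hopfAlgebra k) :=
  ComoduleAlgebra {
    ca_alg :> kalgebra k;
    ca_coact : ca_alg -> tensor ca_alg H;
    ca_coactP : is_coaction ca_coact;
    ca_mul : let A := Comodule ca_coactP in
      @colinear2 k H A A A (@amul k ca_alg);
    ca_one : ca_coact (aone ca_alg) = aone ca_alg ⊗ 1
  }.

Definition ca_comod (k : fieldType) (H : hopfAlgebra k)
  (A : comodule_algebra H) : comodule H := Comodule (ca_coactP A).

Record hmodule_algebra (k : fieldType) (H : hopfAlgebra k) :=
  HModuleAlgebra {
    ha_alg :> kalgebra k;
    ha_act : hdual H -> ha_alg -> ha_alg;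
    ha_actP : is_action ha_act;
    ha_mul : let A := HModule ha_actP in
      @hlinear2 k H A A A (@amul k ha_alg);
    ha_one : forall x, ha_act x (aone ha_alg) = dual_counit x *: aone ha_alg
  }.

Definition ha_hmod (k : fieldType) (H : hopfAlgebra k)
  (A : hmodule_algebra H) : hmodule H := HModule (ha_actP A).

Record comodule_lmod (k : fieldType) (H : hopfAlgebra k)
    (A : comodule_algebra H) := ComoduleLMod {
  cl_comod :> comodule H;
  cl_act : A -> cl_comod -> cl_comod;
  cl_actP : is_module cl_act;
  cl_act_colinear : @colinear2 k H (ca_comod A) cl_comod cl_comod cl_act
}.

Record hmodule_lmod (k : fieldType) (H : hopfAlgebra k)
    (A : hmodule_algebra H) := HModuleLMod {
  hl_hmod :> hmodule H;
  hl_act : A -> hl_hmod -> hl_hmod;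
  hl_actP : is_module hl_act;
  hl_act_hlinear : @hlinear2 k H (ha_hmod A) hl_hmod hl_hmod hl_act
}.

Section Categories.
Variables (k : fieldType) (H : hopfAlgebra k).

Lemma colinear_id (M : comodule H) : @colinear k H M M id.
Proof. by move=> m; rewrite /= tsum_tensE. Qed.

Lemma colinear_comp (M N P : comodule H) (g : N -> P) (f : M -> N) :
  linear g -> linear f -> colinear g -> colinear f -> colinear (g \o f).
Proof.
move=> lg lf cg cf m /=; rewrite cg cf.
have bb : is_bilinear ((fun n h => g n ⊗ h) : N -> H -> tensor P H).
  have [tl tr] := @tens_bilinear k P H.
  by split=> [h c u v | n c u v] /=; [rewrite lg; exact: tl | exact: tr].
rewrite (linear_tsum _ _ (tsum_linear bb)).
by apply: eq_tsum => m0 m1; rewrite tsum_tens.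
Qed.

Lemma colinear0 (M N : comodule H) : @colinear k H M N (fun=> 0).
Proof.
move=> m; have [lr _ _] := coactP N; rewrite linear_map0 //.
have [tl tr] := @tens_bilinear k N H.
by rewrite /tsum big1 // => p _; exact: (linear_map0 (tl _)).
Qed.

Lemma colinearB (M N : comodule H) (f g : M -> N) :
  linear f -> linear g -> colinear f -> colinear g ->
  @colinear k H M N (fun m => f m - g m).
Proof.
move=> lf lg cf cg m; have [lr _ _] := coactP N.
rewrite -scaleN1r addrC lr cf cg scaleN1r addrC /tsum -sumrB.
apply: eq_bigr => p _; have [tl tr] := @tens_bilinear k N H.
have -> : f p.1 - g p.1 = -1 *: g p.1 + f p.1 by rewrite scaleN1r addrC.
by have /= -> := tl p.2 (-1) (g p.1) (f p.1); rewrite scaleN1r addrC.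
Qed.

Definition Comod : preadditive :=
  lin_cat (LinearData colinear_id colinear_comp colinear0 colinearB).

Lemma hlinear_id (M : hmodule H) : @hlinear k H M M id.
Proof. by []. Qed.

Lemma hlinear_comp (M N P : hmodule H) (g : N -> P) (f : M -> N) :
  linear g -> linear f -> hlinear g -> hlinear f -> hlinear (g \o f).
Proof. by move=> _ _ hg hf x m /=; rewrite hf hg. Qed.

Lemma hlinear0 (M N : hmodule H) : @hlinear k H M N (fun=> 0).
Proof.
by move=> x m; have [[_ lr] _ _] := hactP N; rewrite (linear_map0 (lr x)).
Qed.

Lemma hlinearB (M N : hmodule H) (f g : M -> N) :
  linear f -> linear g -> hlinear f -> hlinear g ->
  @hlinear k H M N (fun m => f m - g m).
Proof.
move=> _ _ hf hg x m; have [[_ lr] _ _] := hactP N.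
by rewrite hf hg -scaleN1r addrC -lr scaleN1r addrC.
Qed.

Definition HMod : preadditive :=
  lin_cat (LinearData hlinear_id hlinear_comp hlinear0 hlinearB).

Section LModComod.
Variable A : comodule_algebra H.

Definition cl_linear (M N : comodule_lmod A) (f : M -> N) : Prop :=
  colinear f /\ forall a m, f (cl_act a m) = cl_act a (f m).

Lemma cl_linear_id (M : comodule_lmod A) : @cl_linear M M id.
Proof. by split=> //; exact: colinear_id. Qed.

Lemma cl_linear_comp (M N P : comodule_lmod A) (g : N -> P) (f : M -> N) :
  linear g -> linear f -> cl_linear g -> cl_linear f -> cl_linear (g \o f).
Proof.
move=> lg lf [cg ag] [cf af]; split; first exact: colinear_comp.
by move=> a m /=; rewrite af ag.
Qed.

Lemma cl_linear0 (M N : comodule_lmod A) : @cl_linear M N (fun=> 0).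
Proof.
split; first exact: colinear0.
by move=> a m; have [[_ lr] _ _] := cl_actP N; rewrite (linear_map0 (lr a)).
Qed.

Lemma cl_linearB (M N : comodule_lmod A) (f g : M -> N) :
  linear f -> linear g -> cl_linear f -> cl_linear g ->
  @cl_linear M N (fun m => f m - g m).
Proof.
move=> lf lg [cf af] [cg ag]; split; first exact: colinearB.
move=> a m; have [[_ lr] _ _] := cl_actP N.
by rewrite af ag -scaleN1r addrC -lr scaleN1r addrC.
Qed.

Definition LModComod : preadditive :=
  lin_cat (LinearData cl_linear_id cl_linear_comp cl_linear0 cl_linearB).

Definition forget_LModComod : functor LModComod Comod.
Proof.
refine (@Functor LModComod Comod (@cl_comod k H A)
  (fun X Y f => exist _ (sval f)
     (conj (proj1 (svalP f)) (proj1 (proj2 (svalP f))))) _ _).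
- by move=> X; exact: lin_homP.
- by move=> X Y Z g f; exact: lin_homP.
Defined.
End LModComod.

Section LModHMod.
Variable A : hmodule_algebra H.

Definition hl_linear (M N : hmodule_lmod A) (f : M -> N) : Prop :=
  hlinear f /\ forall a m, f (hl_act a m) = hl_act a (f m).

Lemma hl_linear_id (M : hmodule_lmod A) : @hl_linear M M id.
Proof. by []. Qed.

Lemma hl_linear_comp (M N P : hmodule_lmod A) (g : N -> P) (f : M -> N) :
  linear g -> linear f -> hl_linear g -> hl_linear f -> hl_linear (g \o f).
Proof.
move=> lg lf [cg ag] [cf af]; split; first exact: hlinear_comp.
by move=> a m /=; rewrite af ag.
Qed.

Lemma hl_linear0 (M N : hmodule_lmod A) : @hl_linear M N (fun=> 0).
Proof.
split; first exact: hlinear0.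
by move=> a m; have [[_ lr] _ _] := hl_actP N; rewrite (linear_map0 (lr a)).
Qed.

Lemma hl_linearB (M N : hmodule_lmod A) (f g : M -> N) :
  linear f -> linear g -> hl_linear f -> hl_linear g ->
  @hl_linear M N (fun m => f m - g m).
Proof.
move=> lf lg [cf af] [cg ag]; split; first exact: hlinearB.
move=> a m; have [[_ lr] _ _] := hl_actP N.
by rewrite af ag -scaleN1r addrC -lr scaleN1r addrC.
Qed.

Definition LModHMod : preadditive :=
  lin_cat (LinearData hl_linear_id hl_linear_comp hl_linear0 hl_linearB).

Definition forget_LModHMod : functor LModHMod HMod.
Proof.
refine (@Functor LModHMod HMod (@hl_hmod k H A)
  (fun X Y f => exist _ (sval f)
     (conj (proj1 (svalP f)) (proj1 (proj2 (svalP f))))) _ _).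
- by move=> X; exact: lin_homP.
- by move=> X Y Z g f; exact: lin_homP.
Defined.
End LModHMod.

End Categories.

Section Inclusion.
Variables (k : fieldType) (H : hopfAlgebra k).

Definition coact_act (M : lmodType k) (r : M -> tensor M H)
    (x : hdual H) (m : M) : M :=
  \tsum_(m0, m1 <- r m) (x m1 : k) *: m0.

Lemma coact_act_bilinear (M : lmodType k) (x : hdual H) :
  is_bilinear ((fun m h => (x h : k) *: m) : M -> H -> M).
Proof.
split=> [h c u v | m c u v] /=; first by rewrite scalerDr !scalerA mulrC.
by rewrite linearP scalerDl scalerA.
Qed.

Lemma coact_actP (M : lmodType k) (r : M -> tensor M H) :
  is_coaction r -> is_action (coact_act r).
Proof.
move=> [lr rA r1].
have lx x : linear (coact_act r x).
  by move=> c u v; rewrite /coact_act lr (tsum_linear (coact_act_bilinear _ _)).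
split; first split=> // m.
- apply: linear_of_tsum => v w c x y.
  by rewrite add_lfunE scale_lfunE scalerDl scalerA.
- move=> m; rewrite -[RHS]r1; apply: eq_tsum => v w.
  by rewrite dual_oneE.
- move=> x y m.
  pose b (v : M) (t : tensor H H) : M :=
    \tsum_(a, b <- t) ((x a : k) * y b) *: v.
  have bf (v : M) : is_bilinear
      ((fun a b => ((x a : k) * y b) *: v) : H -> H -> M).
    split=> [h c u w | h c u w] /=; rewrite linear_lfun.
      by rewrite -[c *: x u]/(c * x u) mulrDl scalerDl -mulrA scalerA.
    by rewrite -[c *: y u]/(c * y u) mulrDr scalerDl mulrCA scalerA.
  have bb : is_bilinear b.
    split=> [t | v]; last exact: tsum_linear.
    by apply: linear_of_tsum => a c d u v; rewrite scalerDr !scalerA mulrC.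
  have := congr1 (tsum b) (rA m).
  rewrite !(linear_tsum _ _ (tsum_linear bb)) => e.
  have -> : coact_act r (dual_mul x y) m =
      \tsum_(m0, m1 <- r m)
        tsum b (\tsum_(h1, h2 <- comul m1) m0 ⊗ (h1 ⊗ h2)).
    rewrite /coact_act; apply: eq_tsum => m0 m1; rewrite dual_mulE.
    rewrite (linear_tsum _ _ (tsum_linear bb)) scaler_tsuml.
    by apply: eq_tsum => h1 h2; rewrite tsum_tens // /b tsum_tens.
  rewrite -e.
  rewrite -[coact_act r y m]/(\tsum_(m0, m1 <- r m) (y m1 : k) *: m0).
  rewrite (linear_tsum _ _ (lx x)).
  apply: eq_tsum => m0 m1; rewrite (linear_tsum _ _ (tsum_linear bb)).
  rewrite (linear_mapZ _ (lx x)) /coact_act scaler_tsumr.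
  apply: eq_tsum => m00 m01; rewrite tsum_tens // /b tsum_tens //=.
  by rewrite scalerA mulrC.
Qed.

Definition incl_obj (M : comodule H) : hmodule H :=
  HModule (coact_actP (coactP M)).

Lemma colinear_hlinear (M N : comodule H) (f : M -> N) :
  linear f -> colinear f -> @hlinear k H (incl_obj M) (incl_obj N) f.
Proof.
move=> lf cf x m; rewrite /= /coact_act cf.
rewrite (linear_tsum _ _ (tsum_linear (coact_act_bilinear _ _))).
rewrite (linear_tsum _ _ lf); apply: eq_tsum => m0 m1.
rewrite tsum_tens ?(linear_mapZ _ lf) //; exact: coact_act_bilinear.
Qed.

Lemma colinear2_hlinear2 (M N P : comodule H) (b : M -> N -> P) :
  is_bilinear b -> colinear2 b ->
  @hlinear2 k H (incl_obj M) (incl_obj N) (incl_obj P) b.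
Proof.
move=> [bl br] cb x m n; rewrite /= /coact_act cb.
have lx := tsum_linear (coact_act_bilinear P x).
rewrite (linear_tsum _ _ lx).
transitivity (\tsum_(y, z <- dual_comul x)
   \tsum_(m0, m1 <- coact m) \tsum_(n0, n1 <- coact n)
     (((y : hdual H) m1 : k) * (z : hdual H) n1) *: b m0 n0); last first.
  apply: eq_tsum => y z; rewrite (linear_tsum _ _ (bl _)).
  apply: eq_tsum => m0 m1; rewrite (linear_mapZ _ (bl _)).
  rewrite (linear_tsum _ _ (br _)) scaler_tsumr.
  by apply: eq_tsum => n0 n1; rewrite (linear_mapZ _ (br _)) scalerA.
rewrite [RHS]exchange_tsum; apply: eq_tsum => m0 m1.
rewrite [RHS]exchange_tsum (linear_tsum _ _ lx); apply: eq_tsum => n0 n1.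
rewrite tsum_tens; last exact: coact_act_bilinear.
by rewrite -dual_comulE scaler_tsuml.
Qed.

Definition incl : functor (Comod H) (HMod H).
Proof.
refine (@Functor (Comod H) (HMod H) incl_obj
  (fun X Y f => exist _ (sval f)
    (conj (proj1 (svalP f))
       (colinear_hlinear (proj1 (svalP f)) (proj2 (svalP f))))) _ _).
- by move=> X; exact: lin_homP.
- by move=> X Y Z g f; exact: lin_homP.
Defined.

Section Algebra.
Variable A : comodule_algebra H.

Lemma incl_alg_one x :
  coact_act (@ca_coact k H A) x (aone A) = dual_counit x *: aone A.
Proof.
rewrite /coact_act ca_one tsum_tens //; exact: coact_act_bilinear.
Qed.

Definition incl_alg : hmodule_algebra H :=
  @HModuleAlgebra k H A _ (coact_actP (ca_coactP A))
    (@colinear2_hlinear2 (ca_comod A) (ca_comod A) (ca_comod A) _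
       (amul_bilinear A) (@ca_mul k H A)) incl_alg_one.

Definition incl_lmod_obj (M : comodule_lmod A) : hmodule_lmod incl_alg :=
  @HModuleLMod k H incl_alg (incl_obj M) (@cl_act k H A M) (cl_actP M)
    (@colinear2_hlinear2 (ca_comod A) M M _
       (let: And3 b _ _ := cl_actP M in b) (@cl_act_colinear k H A M)).

Lemma cl_linear_hl_linear (M N : comodule_lmod A) (f : M -> N) :
  linear f -> cl_linear f ->
  @hl_linear k H incl_alg (incl_lmod_obj M) (incl_lmod_obj N) f.
Proof. by move=> lf [cf af]; split=> //; exact: colinear_hlinear. Qed.

Definition incl_lmod : functor (LModComod A) (LModHMod incl_alg).
Proof.
refine (@Functor (LModComod A) (LModHMod incl_alg) incl_lmod_obj
  (fun X Y f => exist _ (sval f)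
    (conj (proj1 (svalP f))
       (cl_linear_hl_linear (proj1 (svalP f)) (proj2 (svalP f))))) _ _).
- by move=> X; exact: lin_homP.
- by move=> X Y Z g f; exact: lin_homP.
Defined.
End Algebra.

End Inclusion.

(* Main.v *)
Require Import Defs.
From mathcomp Require Import all_boot all_order all_algebra all_field.
From mathcomp Require Import boolp classical_sets.
Import Defs.

(** The inclusion i : Comod(H) -> Mod(H'), with H' the dual of H, is an
    equivalence of categories because H is finite-dimensional: an H'-module
    structure on M is the same thing as an H-coaction, namely
    m |-> sum_j e'_j m ⊗ e_j for dual bases e_j and e'_j. The bijection
    respects diagonal structures, so it extends to an equivalence of the
    categories of A-modules ([incl_equivalence], [incl_lmod_equivalence]). An
    equivalence is a left and a right adjoint, and it preserves and reflects
    monomorphisms, epimorphisms, injective objects, hence stable equivalences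
    ([stable_same_classes]), and lifting properties
    ([right_induced_same_classes]). This gives the Quillen properties of both
    inclusions, and carries model structures from the module side to the
    comodule side ([transport_model]).

    There remain two points. The first is that the stable classes on Mod(H') do
    form a model structure. In any additive category with enough injectives and
    projectives, in which the two notions coincide, this is a formal argument
    with idempotents ([frobenius_stable_model]). For Mod(H') the Frobenius
    property rests on the theorem of Larson and Sweedler: a nonzero integral L
    on H gives a nondegenerate form L(g h), hence a left integral t in H with
    L(g t) = eps(g), and H is a free H'-module on t ([regular_comodule_free]).
    Thus M ⊗ H is both cofree and free for every vector space M, and every
    module is a submodule and a quotient of such a module ([hmod_frobenius]).

    The second is that the forgetful functors have left adjoints. On comodules
    it is M |-> A ⊗ M with the diagonal coaction ([free_unit_universal]); the
    case of H'-modules follows by cancelling the equivalence of the categories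
    of A-modules ([universal_arrows_cancel]). *)

Set Implicit Arguments.
Unset Strict Implicit.
Unset Printing Implicit Defensive.

Import GRing.Theory.
Local Open Scope ring_scope.

(** * Linear algebra in arbitrary dimension *)

Section LinearAlgebra.
Variable k : fieldType.

Lemma linear_mapN (V W : lmodType k) (f : V -> W) :
  linear f -> {morph f : x / - x}.
Proof. by move=> lf x; rewrite -scaleN1r (linear_mapZ _ lf) scaleN1r. Qed.

Lemma linear_mapB (V W : lmodType k) (f : V -> W) :
  linear f -> {morph f : x y / x - y}.
Proof. by move=> lf x y; rewrite (linear_mapD lf) (linear_mapN lf). Qed.

Lemma linear_comp (V W U : lmodType k) (g : W -> U) (f : V -> W) :
  linear g -> linear f -> linear (g \o f).
Proof. by move=> lg lf c x y /=; rewrite lf lg. Qed.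

Section Complement.
Variables (V : lmodType k) (S : set V).
Hypotheses (S0 : S 0) (SP : forall c x y, S x -> S y -> S (c *: x + y)).

Let SZ c x : S x -> S (c *: x).
Proof. by move=> Sx; rewrite -[_ *: _]addr0; exact: SP. Qed.
Let SB x y : S x -> S y -> S (x - y).
Proof. by move=> Sx Sy; rewrite -scaleN1r addrC; exact: SP. Qed.

(** Vector spaces of any dimension occur, so the complement comes from Zorn's
    lemma: take T maximal among the subsets closed under linear combinations
    that meet S trivially. If v were not in S + T, then the span of T and v
    would still meet S trivially. The empty set is closed in this sense, whence
    the zero vector is added to T at the end. *)
Lemma exists_complement : exists T : set V,
  [/\ T 0, forall c x y, T x -> T y -> T (c *: x + y),
      forall x, T x -> S x -> x = 0
    & forall v, exists2 t, T t & S (v - t)].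
Proof.
pose P (T : set V) := (forall c x y, T x -> T y -> T (c *: x + y)) /\
  (forall x, T x -> S x -> x = 0).
have [|T [[TP TS] Tmax]] := @Zorn_bigcup V P.
  move=> F FP Ftot; split=> [c x y [B FB Bx] [C FC Cy]|x [B FB Bx]]; last first.
    by have [_] := FP _ FB; apply.
  have [BC|CB] := Ftot _ _ FB FC.
    by exists C => //; have [CP _] := FP _ FC; apply: CP => //; exact: BC.
  by exists B => //; have [BP _] := FP _ FB; apply: BP => //; exact: CB.
pose T0 t := t = 0 \/ T t.
have T0P c x y : T0 x -> T0 y -> T0 (c *: x + y).
  move=> [->|Tx] [->|Ty]; rewrite ?scaler0 ?addr0 ?add0r; first by left.
  - by right.
  - right; have -> : c *: x = (c - 1) *: x + x
      by rewrite scalerBl scale1r subrK.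
    exact: TP.
  - by right; apply: TP.
have T0S x : T0 x -> S x -> x = 0 by case=> // /TS; apply.
exists T0; split=> //; first by left.
move=> v; apply: contrapT => nv.
pose T' w := exists c, exists2 t, T0 t & w = c *: v + t.
have nTv : ~ T v.
  by move=> Tv; apply: nv; exists v; [right | rewrite subrr].
apply: (Tmax T'); split.
- by move=> x Tx; exists 0, x; [right | rewrite scale0r add0r].
- by move=> /(_ v) T'T; apply/nTv/T'T; exists 1, 0;
    [left | rewrite scale1r addr0].
- move=> c _ _ [a [t Tt ->]] [b [u Tu ->]]; exists (c * a + b), (c *: t + u).
    exact: T0P.
  by rewrite scalerDr scalerDl scalerA addrACA.
- move=> _ [c [t Tt ->]] Sx; have [c0|c0] := eqVneq c 0.
    by move: Sx; rewrite c0 scale0r add0r; exact: T0S.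
  case: nv; exists (- c^-1 *: t).
    by rewrite -[_ *: t]addr0; apply: T0P => //; left.
  have := SZ c^-1 Sx.
  by rewrite scalerDr scalerA mulVf // scale1r scaleNr opprK.
Qed.

(** The projection onto a complement of S. It serves both as a linear map whose
    kernel is S and, through v - p v, as a retraction onto S. *)
Lemma exists_projection_along : exists p : V -> V,
  [/\ linear p, forall v, p v = 0 <-> S v & forall v, S (v - p v)].
Proof.
have [T [T0 TP TS dec]] := exists_complement.
have /choice [p pP] : forall v, exists t, T t /\ S (v - t).
  by move=> v; have [t] := dec v; exists t.
have uniq_dec v t : T t -> S (v - t) -> p v = t.
  have [Tp Sp] := pP v => Tt St; apply/eqP; rewrite -subr_eq0; apply/eqP.
  apply: TS; first by rewrite -scaleN1r addrC; apply: TP.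
  by rewrite -(subrKA v) addrC -opprB; have := SB St Sp; rewrite addrC opprB.
have lp : linear p.
  move=> c x y; have [[Tx Sx] [Ty Sy]] := (pP x, pP y); apply: uniq_dec;
    first exact: TP.
  by rewrite opprD addrACA -scalerBr; apply: SP.
exists p; split=> // v; last by have [] := pP v.
split=> [pv0|Sv]; first by have [_] := pP v; rewrite pv0 subr0.
by apply: uniq_dec => //; rewrite subr0.
Qed.
End Complement.

Lemma injective_extension (V W U : lmodType k) (f : V -> W) (g : V -> U) :
  linear f -> injective f -> linear g ->
  exists2 h : W -> U, linear h & forall v, h (f v) = g v.
Proof.
move=> lf fI lg; pose S w := exists v, f v = w.
have [||p [lp p0 pS]] := @exists_projection_along W S.
- by exists 0; rewrite (linear_map0 lf).
- by move=> c _ _ [v <-] [w <-]; exists (c *: v + w); rewrite lf.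
have /choice [r rP] : forall w, exists v, f v = w - p w by [].
exists (g \o r) => [|v /=].
  apply: linear_comp => // c x y; apply: fI.
  by rewrite lf !rP lp scalerBr opprD addrACA.
congr g; apply: fI; rewrite rP (p0 (f v)).2 ?subr0 //.
by exists v.
Qed.

Lemma surjective_section (V W : lmodType k) (f : V -> W) :
  linear f -> (forall w, exists v, f v = w) ->
  exists2 s : W -> V, linear s & cancel s f.
Proof.
move=> lf /choice [s sP]; pose S v := f v = 0.
have [||p [lp p0 pS]] := @exists_projection_along V S.
- exact: linear_map0.
- by move=> c x y fx fy; rewrite /S lf fx fy scaler0 addr0.
(* Two preimages of the same vector differ by an element of the kernel, which
   p kills; so p \o s is linear although s is only a choice of preimages. *)
exists (p \o s) => [c x y /=|w /=].
  apply/eqP; rewrite -lp -subr_eq0 -(linear_mapB lp); apply/eqP/p0.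
  by rewrite /S (linear_mapB lf) lf !sP subrr.
by rewrite -[RHS]sP; apply/eqP; rewrite eq_sym -subr_eq0 -(linear_mapB lf) pS.
Qed.

Lemma injective_endo_onto (V W : vectType k) (f : V -> W) :
  linear f -> \dim {:V} = \dim {:W} -> (forall v, f v = 0 -> v = 0) ->
  forall w, exists v, f v = w.
Proof.
move=> lf dVW f0 w; pose g := linfun f.
have gE v : g v = f v by rewrite /g lfun_of_linearE.
have kg : lker g == 0%VS.
  apply/lker0P => u v; rewrite !gE => e; apply/eqP; rewrite -subr_eq0;
    apply/eqP.
  by apply: f0; rewrite (linear_mapB lf) e subrr.
have : w \in limg g.
  suff -> : limg g = fullv by exact: memvf.
  apply/eqP; rewrite eqEdim subvf -dVW limg_dim_eq //=.
  by rewrite (eqP kg) capv0.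
by case/memv_imgP => v _ ->; exists v; rewrite gE.
Qed.

End LinearAlgebra.

(** * Tensor products and contractions *)

Section TensorTheory.
Variable k : fieldType.
Implicit Types V W U : lmodType k.

Lemma tensorDl V W (v v' : V) (w : W) : (v + v') ⊗ w = v ⊗ w + v' ⊗ w.
Proof.
by have [tl _] := @tens_bilinear k V W; rewrite (linear_mapD (tl w)).
Qed.

Lemma tensorDr V W (v : V) (w w' : W) : v ⊗ (w + w') = v ⊗ w + v ⊗ w'.
Proof.
by have [_ tr] := @tens_bilinear k V W; rewrite (linear_mapD (tr v)).
Qed.

Lemma tensorZl V W c (v : V) (w : W) : (c *: v) ⊗ w = c *: (v ⊗ w).
Proof.
by have [tl _] := @tens_bilinear k V W; rewrite (linear_mapZ _ (tl w)).
Qed.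

Lemma tensorZr V W c (v : V) (w : W) : v ⊗ (c *: w) = c *: (v ⊗ w).
Proof.
by have [_ tr] := @tens_bilinear k V W; rewrite (linear_mapZ _ (tr v)).
Qed.

Lemma tensor_sumr V W I (r : seq I) (v : V) (F : I -> W) :
  v ⊗ (\sum_(i <- r) F i) = \sum_(i <- r) v ⊗ F i.
Proof.
by have [_ tr] := @tens_bilinear k V W; rewrite (linear_map_sum _ _ _ (tr v)).
Qed.

Lemma linear_tensl V W (w : W) : linear (fun v : V => v ⊗ w).
Proof. by have [tl _] := @tens_bilinear k V W; exact: tl. Qed.

Lemma linear_tensr V W (v : V) : linear (fun w : W => v ⊗ w).
Proof. by have [_ tr] := @tens_bilinear k V W; exact: tr. Qed.

(** The way to prove identities in a tensor product: the elements v ⊗ w span,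
    so two linear maps agree as soon as they agree on these. *)
Lemma tensor_linear_ext V W U (f g : tensor V W -> U) :
  linear f -> linear g -> (forall v w, f (v ⊗ w) = g (v ⊗ w)) -> f =1 g.
Proof.
move=> lf lg e t; rewrite -[t]tsum_tensE.
by rewrite (linear_tsum _ _ lf) (linear_tsum _ _ lg); apply: eq_tsum.
Qed.

Lemma bilinear_tens V W V' W' (f : V -> V') (g : W -> W') :
  linear f -> linear g -> is_bilinear (fun v w => f v ⊗ g w).
Proof.
move=> lf lg; split=> [w c u v | v c u w]; rewrite ?lf ?lg.
  by rewrite tensorDl tensorZl.
by rewrite tensorDr tensorZr.
Qed.

Lemma bilinear_comp V W U U' (f : U -> U') (b : V -> W -> U) :
  linear f -> is_bilinear b -> is_bilinear (fun v w => f (b v w)).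
Proof. by move=> lf [bl br]; split=> [w|v] c x y /=; rewrite (bl, br) lf. Qed.

Lemma linear_tsum_comp V W U (X : lmodType k) (b : V -> W -> U)
    (r : X -> tensor V W) :
  is_bilinear b -> linear r -> linear (fun x => tsum b (r x)).
Proof. by move=> bb lr c x y; rewrite lr (tsum_linear bb). Qed.

End TensorTheory.

Section Slices.
Variables (k : fieldType) (H : hopfAlgebra k).
Implicit Types V W : lmodType k.

Definition hbasis (i : 'I_(\dim {:H})) : H := (vbasis {:H})`_i.
Definition dbasis (i : 'I_(\dim {:H})) : hdual H :=
  linfun (coord (vbasis {:H}) i : H -> k^o).

Lemma dbasisE i h : dbasis i h = coord (vbasis {:H}) i h.
Proof. by rewrite /dbasis lfun_of_linearE // => c u v; rewrite linearP. Qed.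

Lemma hbasis_expand h : h = \sum_i (dbasis i h : k) *: hbasis i.
Proof.
by rewrite {1}(coord_vbasis (memvf h)); apply: eq_bigr => i _; rewrite dbasisE.
Qed.

Lemma dbasis_expand (x : hdual H) : x = \sum_i (x (hbasis i) : k) *: dbasis i.
Proof.
apply/lfunP => h; rewrite {1}(hbasis_expand h) linear_sum sum_lfunE.
by apply: eq_bigr => i _; rewrite linearZ scale_lfunE; exact: mulrC.
Qed.

Lemma hdual_separates (h g : H) : (forall x : hdual H, x h = x g) -> h = g.
Proof.
move=> e; rewrite (hbasis_expand h) (hbasis_expand g).
by apply: eq_bigr => i _; rewrite e.
Qed.

(** The contraction of t with x in the second factor, i.e. the map id ⊗ x. *)
Definition slice V (x : hdual H) (t : tensor V H) : V :=
  \tsum_(v, h <- t) (x h : k) *: v.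

Lemma slice_linear V x : linear (@slice V x).
Proof. exact: tsum_linear (coact_act_bilinear _ _). Qed.

Lemma slice_tens V x (v : V) h : slice x (v ⊗ h) = (x h : k) *: v.
Proof. by rewrite /slice tsum_tens //; exact: coact_act_bilinear. Qed.

Lemma slice_linearl V (t : tensor V H) : linear (fun x => slice x t).
Proof.
apply: linear_of_tsum => v h c x y.
by rewrite add_lfunE scale_lfunE scalerDl scalerA.
Qed.

Lemma slice_expand V (t : tensor V H) :
  t = \sum_i slice (dbasis i) t ⊗ hbasis i.
Proof.
move: t; apply: (@tensor_linear_ext _ _ _ _ id) => // [c t u|v h].
  rewrite scaler_sumr -big_split; apply: eq_bigr => i _ /=.
  by rewrite slice_linear tensorDl tensorZl.
rewrite [in LHS](hbasis_expand h) tensor_sumr; apply: eq_bigr => i _.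
by rewrite slice_tens tensorZl tensorZr.
Qed.

(** H is finite-dimensional, so the contractions with the elements of the dual
    separate the elements of V ⊗ H. Questions about coactions thus become
    questions about actions of the dual. *)
Lemma sliceP V (t u : tensor V H) : (forall x, slice x t = slice x u) -> t = u.
Proof.
move=> e; rewrite (slice_expand t) (slice_expand u).
by apply: eq_bigr => i _; rewrite e.
Qed.

(** The left action of the dual on H, usually written with a harpoon: x sends h
    to h_(1) x(h_(2)). *)
Definition hit (x : hdual H) (h : H) : H := slice x (comul h).

Lemma regular_coactionP : is_coaction (@comul k H).
Proof.
by split; [exact: comul_linear | exact: comulA | exact: counit_comulr].
Qed.

Lemma hit_actionP : is_action hit.
Proof. exact: coact_actP regular_coactionP. Qed.

Lemma dual_mul_hit (x y : hdual H) h : dual_mul x y h = x (hit y h).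
Proof.
rewrite dual_mulE /hit /slice (linear_tsum _ _ (@linear_lfun _ _ _ x)).
by apply: eq_tsum => a b; rewrite linearZ; exact: mulrC.
Qed.

End Slices.

(** * Integrals of a finite-dimensional Hopf algebra *)

Section Integrals.
Variables (k : fieldType) (H : hopfAlgebra k).

Definition is_trilinear (M N P U : lmodType k) (T : M -> N -> P -> U) :=
  [/\ forall n p, linear (fun m => T m n p),
      forall m p, linear (fun n => T m n p)
    & forall m n, linear (T m n)].

(** Coassociativity in the form used in computations with Sweedler's notation:
    it may be applied inside any expression that is linear in each leg. *)
Lemma coact_coassoc (M U : lmodType k) (r : M -> tensor M H)
    (T : M -> H -> H -> U) m :
  is_coaction r -> is_trilinear T ->
  \tsum_(m0, m1 <- r m) \tsum_(m00, m01 <- r m0) T m00 m01 m1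
    = \tsum_(m0, m1 <- r m) \tsum_(h1, h2 <- comul m1) T m0 h1 h2.
Proof.
move=> [_ rA _] [T1 T2 T3].
have bT a : is_bilinear (T a) by split=> *; [exact: T2 | exact: T3].
pose F (a : M) (t : tensor H H) := tsum (T a) t.
have bF : is_bilinear F.
  by split=> [t|a]; [exact: linear_of_tsum | exact: tsum_linear].
have := congr1 (tsum F) (rA m).
rewrite !(linear_tsum _ _ (tsum_linear bF)) => e.
have {}e : \tsum_(m0, m1 <- r m) \tsum_(m00, m01 <- r m0) F m00 (m01 ⊗ m1) =
    \tsum_(m0, m1 <- r m) \tsum_(h1, h2 <- comul m1) F m0 (h1 ⊗ h2).
  move: e; congr (_ = _); apply: eq_tsum => a b;
    rewrite (linear_tsum _ _ (tsum_linear bF));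
  by apply: eq_tsum => c d; rewrite tsum_tens.
move: e; congr (_ = _); apply: eq_tsum => a b; apply: eq_tsum => c d;
  exact: tsum_tens.
Qed.

(** The functional y(g -), which is the right action of g on y. *)
Definition precomp_mul (g : H) (y : hdual H) : hdual H :=
  linfun (fun h => y (g * h) : k^o).

Lemma precomp_mulE g y h : precomp_mul g y h = y (g * h).
Proof.
by rewrite /precomp_mul lfun_of_linearE // => c u v;
  rewrite mulrDr -scalerAr linearP.
Qed.

Lemma hdual_linear (y : hdual H) c g h :
  y (c *: g + h) = (c * (y g : k) + (y h : k) : k).
Proof. exact: linear_lfun. Qed.

Lemma hdualZ (y : hdual H) c g : y (c *: g) = (c * (y g : k) : k).
Proof. exact: (linear_mapZ _ (@linear_lfun _ _ _ y)). Qed.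

Lemma hdual_sum (y : hdual H) I (r : seq I) (F : I -> H) :
  y (\sum_(i <- r) F i) = (\sum_(i <- r) (y (F i) : k) : k).
Proof. exact: (linear_map_sum _ _ _ (@linear_lfun _ _ _ y)). Qed.

Lemma precomp_mul_linear y : linear (precomp_mul^~ y).
Proof.
move=> c u v; apply/lfunP => h; rewrite add_lfunE scale_lfunE !precomp_mulE.
by rewrite mulrDl -scalerAl linearP.
Qed.

Lemma hit_precomp_mul_linear y h : linear (fun g => hit (precomp_mul g y) h).
Proof. by move=> c u v; rewrite precomp_mul_linear /hit slice_linearl. Qed.

Lemma hit_linear y : linear (hit y : H -> H).
Proof. by have [[]] := hit_actionP H. Qed.

Lemma linear_mull (g : H) : linear (fun h : H => g * h).
Proof. by move=> c u v; rewrite mulrDr scalerAr. Qed.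

Lemma linear_mulr (g : H) : linear (fun h : H => h * g).
Proof. by move=> c u v; rewrite mulrDl scalerAl. Qed.

Lemma hitM y g h :
  hit y (g * h) = \tsum_(a, b <- comul g) a * hit (precomp_mul b y) h.
Proof.
rewrite /hit comulM (linear_tsum _ _ (slice_linear _)).
apply: eq_tsum => a b; rewrite (linear_tsum _ _ (slice_linear _)).
rewrite /slice (linear_tsum _ _ (linear_mull a)); apply: eq_tsum => c d.
by rewrite -/(slice _ _) slice_tens precomp_mulE -scalerAr.
Qed.

(** In Sweedler's notation
      h_(1) y(g h_(2)) = S(g_(1)) (g_(2) h)_(1) y((g_(2) h)_(2)).
    Expanding the coproduct of g_(2) h turns the right-hand side into
    S(g_(1)) g_(2) h_(1) y(g_(3) h_(2)), where S(g_(1)) g_(2) collapses to a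
    counit. Everything below on integrals comes from this identity. *)
Lemma hit_precomp_mul y g h :
  hit (precomp_mul g y) h = \tsum_(a, b <- comul g) antipode a * hit y (b * h).
Proof.
pose T (a b c : H) := antipode a * (b * hit (precomp_mul c y) h).
have TT : is_trilinear T.
  rewrite /T; split=> [b c|a c|a b] d u v.
  - by rewrite (@antipode_linear k H) mulrDl scalerAl.
  - by rewrite mulrDl -scalerAl (linear_mull (antipode a)).
  - by rewrite hit_precomp_mul_linear (linear_mull b)
      (linear_mull (antipode a)).
transitivity (\tsum_(a, b <- comul g) \tsum_(b1, b2 <- comul b) T a b1 b2);
  last first.
  apply: eq_tsum => a b; rewrite hitM.
  by rewrite (linear_tsum _ _ (linear_mull (antipode a))).
rewrite -(coact_coassoc _ (regular_coactionP H) TT).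
rewrite -[g in LHS](@counit_comull k H) (linear_tsum _ _
  (hit_precomp_mul_linear y h)).
apply: eq_tsum => a b; rewrite (linear_mapZ _ (hit_precomp_mul_linear y h)).
rewrite -(mul1r (hit _ _)) scalerAl -(@antipode_comull k H).
rewrite (linear_tsum _ _ (linear_mulr (hit (precomp_mul b y) h))).
by apply: eq_tsum => a1 a2; rewrite /T mulrA.
Qed.

Lemma counit_klinear : linear (@counit k H : H -> k^o).
Proof. exact: counit_linear. Qed.

Lemma counit_expand h (x : hdual H) :
  x h = \tsum_(a, b <- comul h) ((x a : k) * counit b : k^o).
Proof.
rewrite -[in LHS](@counit_comulr k H h) (linear_tsum _ _
  (@linear_lfun _ _ _ x)).
by apply: eq_tsum => a b; rewrite hdualZ; exact: mulrC.
Qed.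

Section Nondegenerate.
Variable L : hdual H.
Hypothesis L_int : forall h, hit L h = (L h : k) *: 1.
Hypothesis L_neq0 : exists h, L h != 0.

Let N h := forall g, L (g * h) = 0.

Let hit_N h g : N h -> hit (precomp_mul g L) h = 0.
Proof.
move=> Nh; rewrite hit_precomp_mul /tsum big1 // => p _.
by rewrite L_int Nh scale0r mulr0.
Qed.

Let counit_N h : N h -> counit h = 0.
Proof.
move=> Nh; have [g /eqP Lg] := L_neq0; apply/eqP/contraT => /eqP eh.
have [] := Lg; suff : (counit h *: L g : k^o) = 0.
  by move=> /eqP; rewrite scaler_eq0 => /orP[/eqP //|/eqP].
rewrite -(linear_mapZ _ (@linear_lfun _ _ _ L)).
transitivity (L (g * (counit h *: 1))); first by rewrite -scalerAr mulr1.
rewrite -(@antipode_comull k H) (linear_tsum _ _ (linear_mull g)).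
rewrite (linear_tsum _ _ (@linear_lfun _ _ _ L)).
(* Expand S(h_(1)) in order to pull it out of L: each term is then a
   contraction of h_(1) L(g' h_(2)), which is zero. *)
transitivity (\tsum_(a, b <- comul h)
  \sum_i (dbasis i a : k) *: L (g * antipode (hbasis i) * b)).
  apply: eq_tsum => a b; rewrite {1}(hbasis_expand a).
  rewrite (linear_map_sum _ _ _ (@antipode_linear k H)).
  rewrite mulr_suml (linear_map_sum _ _ _ (linear_mull g)) hdual_sum.
  apply: eq_bigr => i _; rewrite (linear_mapZ _ (@antipode_linear k H)).
  by rewrite -scalerAl -scalerAr hdualZ mulrA.
rewrite /tsum exchange_big big1 // => i _.
transitivity (dbasis i (hit (precomp_mul (g * antipode (hbasis i)) L) h));
  last first.
  by rewrite hit_N // linear0.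
rewrite /hit /slice (linear_tsum _ _ (@linear_lfun _ _ _ (dbasis i))).
apply: eq_bigr => p _; rewrite hdualZ precomp_mulE; exact: mulrC.
Qed.

(** An integral L on H makes H a Frobenius algebra. Let N be the set of h with
    L(H h) = 0. Since hit L is a multiple of 1 on every element,
    [hit_precomp_mul] gives h_(1) ⊗ h_(2) in H ⊗ N for h in N. As N is a left
    ideal, S(h_(1)) h_(2) = eps(h) 1 lies in N too, and 1 is not in N; so eps
    vanishes on N, and h = h_(1) eps(h_(2)) = 0. *)
Lemma integral_nondegenerate h : (forall g, L (g * h) = 0) -> h = 0.
Proof.
move=> Nh; apply: hdual_separates => x; rewrite linear0.
(* The element x(h_(1)) h_(2) of N. *)
pose n := \tsum_(a, b <- comul h) (x a : k) *: b.
have Nn : N n.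
  move=> g; rewrite (linear_tsum _ _ (linear_mull g)).
  rewrite (linear_tsum _ _ (@linear_lfun _ _ _ L)).
  transitivity (x (hit (precomp_mul g L) h)); last by rewrite hit_N // linear0.
  rewrite /hit /slice (linear_tsum _ _ (@linear_lfun _ _ _ x)).
  apply: eq_tsum => a b; rewrite hdualZ precomp_mulE -scalerAr hdualZ;
    exact: mulrC.
rewrite counit_expand -[RHS](counit_N Nn) (linear_tsum _ _ counit_klinear).
by apply: eq_tsum => a b; rewrite (linear_mapZ _ counit_klinear).
Qed.

(** By nondegeneracy and equality of dimensions, h |-> L(- h) is onto the dual.
    The preimage of the counit is a left integral, because L cannot tell h g t
    from eps(g) h t. *)
Lemma exists_left_integral : exists t : H,
  [/\ forall g, L (g * t) = counit g & forall g, g * t = counit g *: t].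
Proof.
pose B (h : H) : hdual H := linfun (fun g => L (g * h) : k^o).
have BE h g : B h g = L (g * h).
  by rewrite /B lfun_of_linearE // => c u v; rewrite linear_mulr linearP.
have lB : linear B.
  move=> c u v; apply/lfunP => g; rewrite add_lfunE scale_lfunE !BE.
  by rewrite linear_mull linearP.
have [|h Bh|t Bt] := @injective_endo_onto k H (hdual H) B lB _ _ (dual_one H).
- by rewrite !dimvf /= /dim /= muln1.
- by apply: integral_nondegenerate => g; rewrite -BE Bh zero_lfunE.
exists t; have Lt g : L (g * t) = counit g by rewrite -BE Bt dual_oneE.
split=> // g; apply/eqP; rewrite -subr_eq0; apply/eqP.
apply: integral_nondegenerate => h.
rewrite (linear_mapB (linear_mull h)) (linear_mapB (@linear_lfun _ _ _ L))
  -scalerAr hdualZ mulrA /= !Lt.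
by rewrite (@counitM k H) [X in _ - X]mulrC subrr.
Qed.

Section Generator.
Variable t : H.
Hypothesis Lt : forall g, L (g * t) = counit g.
Hypothesis t_int : forall g, g * t = counit g *: t.

Let hit_shift_t y g : hit y t = 0 -> hit (precomp_mul g y) t = 0.
Proof.
move=> yt; rewrite hit_precomp_mul /tsum big1 // => p _.
by rewrite t_int (linear_mapZ _ (hit_linear y)) yt scaler0 mulr0.
Qed.

Let hit_t_at1 (y : hdual H) : hit y t = 0 -> y 1 = 0.
Proof.
move=> yt; have Lt1 : L t = 1 by rewrite -[t]mul1r Lt (@counit1 k H).
suff : (y 1 : k) *: t = 0.
  move=> /(congr1 L); rewrite hdualZ linear0 /= Lt1 => e.
  by rewrite -[y 1]mulr1 -[RHS]e.
pose T (a b c : H) : H := (y (antipode b * c) : k) *: a.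
have TT : is_trilinear T.
  rewrite /T; split=> [b c|a c|a b] d u v.
  - by rewrite scalerDr !scalerA mulrC.
  - by rewrite (@antipode_linear k H) linear_mulr hdual_linear scalerDl scalerA.
  - by rewrite linear_mull hdual_linear scalerDl scalerA.
(* t_(1) y(S(t_(2)) t_(3)), bracketed on the right. *)
transitivity (\tsum_(a, b <- comul t) \tsum_(b1, b2 <- comul b) T a b1 b2).
  rewrite -[t in LHS](@counit_comulr k H) scaler_tsumr; apply: eq_tsum => a b.
  transitivity (((\tsum_(b1, b2 <- comul b) y (antipode b1 * b2)) : k) *: a).
    rewrite -(linear_tsum _ _ (@linear_lfun _ _ _ y)) (@antipode_comull k H).
    by rewrite hdualZ scalerA mulrC.
  by rewrite (scaler_tsuml (fun b1 b2 => y (antipode b1 * b2))).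
rewrite -(coact_coassoc _ (regular_coactionP H) TT).
transitivity (\tsum_(a, b <- comul t) \tsum_(a1, a2 <- comul a) \sum_i
   ((dbasis i (antipode a2) : k) * (y (hbasis i * b) : k)) *: a1).
  apply: eq_tsum => a b; apply: eq_tsum => a1 a2.
  rewrite /T {1}(hbasis_expand (antipode a2)) mulr_suml hdual_sum scaler_suml.
  by apply: eq_bigr => i _; rewrite -scalerAl hdualZ.
pose z i : hdual H := linfun (fun h => dbasis i (antipode h) : k^o).
have zE i h : z i h = dbasis i (antipode h).
  by rewrite /z lfun_of_linearE // => c u v;
    rewrite (@antipode_linear k H) linearP.
transitivity (\sum_i hit (z i) (hit (precomp_mul (hbasis i) y) t)); last first.
  rewrite big1 // => i _; rewrite hit_shift_t //.
  exact: linear_map0 (hit_linear _).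
rewrite {1}/tsum; under eq_bigr do rewrite /tsum exchange_big /=.
rewrite exchange_big; apply: eq_bigr => i _.
rewrite {2}/hit /slice (linear_tsum _ _ (hit_linear _)).
apply: eq_bigr => p _; rewrite (linear_mapZ _ (hit_linear _)) /hit /slice.
rewrite scaler_tsumr; apply: eq_bigr => q _.
by rewrite scalerA zE precomp_mulE mulrC.
Qed.

(** Dual to [integral_nondegenerate]. If hit y t = 0, then by [hit_precomp_mul]
    and the integral property of t the same holds for every functional y(g -),
    so that it is enough to show y(1) = 0. Now y(1) t = t_(1) y(S(t_(2)) t_(3))
    by the antipode axiom, and the right-hand side vanishes, as t_(3) is
    contracted there with functionals of the form y(g -). *)
Lemma hit_integral_inj (y : hdual H) : hit y t = 0 -> y = 0.
Proof.
move=> yt; apply/lfunP => g; rewrite zero_lfunE -[g]mulr1 -precomp_mulE.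
exact/hit_t_at1/hit_shift_t.
Qed.

Lemma hit_integral_onto h : exists y : hdual H, hit y t = h.
Proof.
apply: (@injective_endo_onto k (hdual H) H (fun y => hit y t)).
- exact: slice_linearl.
- by rewrite !dimvf /= /dim /= muln1.
- exact: hit_integral_inj.
Qed.
End Generator.
End Nondegenerate.

(** The regular comodule H is a free module of rank one over the dual of H:
    this is the form in which the coFrobenius property is used. *)
Lemma regular_comodule_free : cofrobenius H ->
  exists t : H, (forall y : hdual H, hit y t = 0 -> y = 0) /\
    forall h, exists y : hdual H, hit y t = h.
Proof.
move=> [l [ll [h lh] l_int]]; pose L : hdual H := linfun (l : H -> k^o).
have LE g : L g = l g by rewrite /L lfun_of_linearE.
have L_int g : hit L g = (L g : k) *: 1.
  by rewrite LE -l_int; apply: eq_tsum => a b; rewrite LE.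
have Ln0 : exists g, L g != 0 by exists h; rewrite LE.
have [t [Lt t_int]] := exists_left_integral L_int Ln0.
by exists t; split; [exact: hit_integral_inj Lt t_int | exact: hit_integral_onto
  Lt t_int].
Qed.
End Integrals.

(** * Comodules as modules over the dual *)

Section CoactionOfAction.
Variables (k : fieldType) (H : hopfAlgebra k).

Section Module.
Variables (M : lmodType k) (act : hdual H -> M -> M).

(** The only candidate for a coaction inducing the given action: its
    contraction with x must be the action of x. *)
Definition act_coact (m : M) : tensor M H := \sum_i act (dbasis i) m ⊗ hbasis i.

Hypothesis actP : is_action act.

Lemma act_expand x m : act x m = \sum_i (x (hbasis i) : k) *: act (dbasis i) m.
Proof.
have [[al _] _ _] := actP; rewrite {1}(dbasis_expand x).
rewrite (linear_map_sum _ _ _ (al m)); apply: eq_bigr => i _.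
by rewrite (linear_mapZ _ (al m)).
Qed.

Lemma slice_act_coact x m : slice x (act_coact m) = act x m.
Proof.
rewrite (linear_map_sum _ _ _ (slice_linear x)) [RHS]act_expand.
by apply: eq_bigr => i _; rewrite slice_tens.
Qed.

Lemma act_coact_linear : linear act_coact.
Proof.
have [[_ ar] _ _] := actP => c u v; apply: sliceP => x.
by rewrite slice_linear !slice_act_coact ar.
Qed.

(** The structure constants of the coproduct of H are those of the product of
    its dual. *)
Lemma comul_expand (h : H) :
  comul h = \sum_i \sum_j
    (dual_mul (dbasis i) (dbasis j) h : k) *: (hbasis i ⊗ hbasis j).
Proof.
rewrite {1}(slice_expand (comul h)) exchange_big; apply: eq_bigr => j _.
rewrite {1}(hbasis_expand (slice _ _)).
rewrite (linear_map_sum _ _ _ (linear_tensl (hbasis j))); apply: eq_bigr => i _.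
by rewrite tensorZl dual_mul_hit.
Qed.

(** Both sides of coassociativity expand, in the basis of H ⊗ H, into the
    actions of the products of two elements of the dual basis. *)
Lemma act_coactP : is_coaction act_coact.
Proof.
have [[al ar] a1 aM] := actP.
split=> [|m|m]; first exact: act_coact_linear.
- have tb (U : lmodType k) (u : U) : is_bilinear
    (fun (v : M) (h : H) => v ⊗ (h ⊗ u)).
    by apply: bilinear_tens => //; exact: linear_tensl.
  have tc : is_bilinear (fun (v : M) (h : H) =>
    \tsum_(h1, h2 <- comul h) v ⊗ (h1 ⊗ h2)).
    split=> [h|v].
      by apply: linear_of_tsum => a b; exact: linear_tensl.
    apply: linear_tsum_comp; last exact: comul_linear.
    apply: bilinear_comp; [exact: linear_tensr | exact: tens_bilinear].
  have td : is_bilinear (fun (v : M) (h : H) =>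
    \tsum_(v0, v1 <- act_coact v) v0 ⊗ (v1 ⊗ h)).
    split=> [h|v].
      by apply: linear_tsum_comp; [exact: tb | exact: act_coact_linear].
    apply: linear_of_tsum => a b c x y.
    by rewrite linear_tensr linear_tensr.
  rewrite {1}/act_coact (linear_map_sum _ _ _ (tsum_linear td)).
  rewrite {2}/act_coact (linear_map_sum _ _ _ (tsum_linear tc)).
  transitivity (\sum_i \sum_j act (dual_mul (dbasis j) (dbasis i)) m ⊗
    (hbasis j ⊗ hbasis i)).
    apply: eq_bigr => i _; rewrite tsum_tens // /act_coact.
    rewrite (linear_map_sum _ _ _ (tsum_linear (tb _ _))).
    by apply: eq_bigr => j _; rewrite tsum_tens // aM.
  transitivity (\sum_l act (dbasis l) m ⊗ comul (hbasis l)).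
    under [RHS]eq_bigr => l _.
      rewrite comul_expand tensor_sumr; under eq_bigr => i _.
        rewrite tensor_sumr; under eq_bigr do rewrite tensorZr -tensorZl.
        over.
      over.
    rewrite /= exchange_big [RHS]exchange_big; apply: eq_bigr => i _.
    rewrite [RHS]exchange_big; apply: eq_bigr => j _.
    rewrite [X in X ⊗ _]act_expand.
    by rewrite (linear_map_sum _ _ _ (linear_tensl _)).
  apply: eq_bigr => l _; rewrite tsum_tens //.
  by rewrite -(linear_tsum _ _ (linear_tensr _)) tsum_tensE.
- rewrite -[RHS]a1 -slice_act_coact; apply: eq_tsum => v h.
  by rewrite dual_oneE.
Qed.
End Module.

Definition coincl_obj (M : hmodule H) :
  comodule H := Comodule (act_coactP (hactP M)).

Lemma incl_coincl_hact (M : hmodule H) x (m : M) :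
  @hact k H (incl_obj (coincl_obj M)) x m = hact x m.
Proof. by rewrite -[RHS](slice_act_coact (hactP M)). Qed.

Lemma hlinear_colinear (M N : comodule H) (f : M -> N) :
  linear f -> @hlinear k H (incl_obj M) (incl_obj N) f -> colinear f.
Proof.
move=> lf hf m; apply: sliceP => x.
rewrite (linear_tsum _ _ (slice_linear x))
  -[slice x (coact _)]/(hact (h := incl_obj N) x (f m)).
rewrite -hf /= /coact_act (linear_tsum _ _ lf); apply: eq_tsum => v h.
by rewrite slice_tens (linear_mapZ _ lf).
Qed.

(** The converse of [colinear2_hlinear2]: after contraction with x, the
    diagonal coaction becomes the action of x through its coproduct. *)
Lemma hlinear2_colinear2 (M N P : comodule H) (b : M -> N -> P) :
  is_bilinear b ->
  @hlinear2 k H (incl_obj M) (incl_obj N) (incl_obj P) b -> colinear2 b.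
Proof.
move=> [bl br] hb m n; apply: sliceP => x.
rewrite -[slice x (coact _)]/(hact (h := incl_obj P) x (b m n)) hb.
rewrite (linear_tsum _ _ (slice_linear x)).
transitivity (\tsum_(y, z <- dual_comul x)
   \tsum_(m0, m1 <- coact m) \tsum_(n0, n1 <- coact n)
     (((y : hdual H) m1 : k) * (z : hdual H) n1) *: b m0 n0).
  apply: eq_tsum => y z; rewrite /= /coact_act (linear_tsum _ _ (bl _)).
  apply: eq_tsum => m0 m1; rewrite (linear_mapZ _ (bl _)).
  rewrite (linear_tsum _ _ (br _)) scaler_tsumr.
  by apply: eq_tsum => n0 n1; rewrite (linear_mapZ _ (br _)) scalerA.
rewrite exchange_tsum; apply: eq_tsum => m0 m1.
rewrite exchange_tsum (linear_tsum _ _ (slice_linear x));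
  apply: eq_tsum => n0 n1.
by rewrite slice_tens -dual_comulE scaler_tsuml.
Qed.

End CoactionOfAction.

(** * The stable model structure of a Frobenius category *)

Section Preadditive.
Variable C : preadditive.
Implicit Types X Y Z : pobj C.
Local Notation "g ∘ f" := (pcomp g f) (at level 40, left associativity).
Local Notation id1 X := (pidm X).

Lemma pcomp0l X Y Z (f : phom X Y) : (0 : phom Y Z) ∘ f = 0.
Proof. by apply: (addrI (0 ∘ f)); rewrite -pcompDl !addr0. Qed.

Lemma pcomp0r X Y Z (g : phom Y Z) : g ∘ (0 : phom X Y) = 0.
Proof. by apply: (addrI (g ∘ 0)); rewrite -pcompDr !addr0. Qed.

Lemma pcompNl X Y Z (g : phom Y Z) (f : phom X Y) : (- g) ∘ f = - (g ∘ f).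
Proof. by apply/eqP; rewrite -addr_eq0 -pcompDl addNr pcomp0l. Qed.

Lemma pcompNr X Y Z (g : phom Y Z) (f : phom X Y) : g ∘ (- f) = - (g ∘ f).
Proof. by apply/eqP; rewrite -addr_eq0 -pcompDr addNr pcomp0r. Qed.

Lemma pcompBl X Y Z (g g' : phom Y Z) (f : phom X Y) :
  (g - g') ∘ f = g ∘ f - g' ∘ f.
Proof. by rewrite pcompDl pcompNl. Qed.

Lemma pcompBr X Y Z (g : phom Y Z) (f f' : phom X Y) :
  g ∘ (f - f') = g ∘ f - g ∘ f'.
Proof. by rewrite pcompDr pcompNr. Qed.

Definition projective_obj (P : pobj C) : Prop :=
  forall X Y (p : phom X Y) (f : phom P Y), @epi C X Y p -> exists g, p ∘ g = f.

Definition has_biproducts : Prop := forall X Y, exists Z,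
  exists (i1 : phom X Z) (i2 : phom Y Z) (p1 : phom Z X) (p2 : phom Z Y),
  [/\ p1 ∘ i1 = id1 X, p2 ∘ i2 = id1 Y, p1 ∘ i2 = 0, p2 ∘ i1 = 0
    & i1 ∘ p1 + i2 ∘ p2 = id1 Z].

(** The properties of an abelian Frobenius category on which the stable model
    structure rests. The objects covering each object are required to be
    injective; they are projective by the last property. *)
Record frobenius : Prop := Frobenius {
  frob_biproducts : has_biproducts;
  frob_enough_injectives : forall X, exists I (m : phom X I),
    @injective_obj C I /\ @mono C X I m;
  frob_enough_projectives : forall X, exists P (e : phom P X),
    @injective_obj C P /\ @epi C P X e;
  frob_injective_projective : forall I, @injective_obj C I -> projective_obj I
}.

Lemma mono_of_kernel X Y (f : phom X Y) :
  (forall Z (g : phom Z X), f ∘ g = 0 -> g = 0) -> @mono C X Y f.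
Proof.
move=> f0 Z g h /= e; apply/eqP; rewrite -subr_eq0; apply/eqP/f0.
by rewrite pcompBr; apply/eqP; rewrite subr_eq0; apply/eqP.
Qed.

Lemma epi_of_cokernel X Y (f : phom X Y) :
  (forall Z (g : phom Y Z), g ∘ f = 0 -> g = 0) -> @epi C X Y f.
Proof.
move=> f0 Z g h /= e; apply/eqP; rewrite -subr_eq0; apply/eqP/f0.
by rewrite pcompBl; apply/eqP; rewrite subr_eq0; apply/eqP.
Qed.

Section Stable.
Hypothesis frobC : frobenius.

Local Notation fi := (@factors_injective C _ _).

Lemma injective_biproduct I J Z (i1 : phom I Z) (i2 : phom J Z) p1 p2 :
  i1 ∘ p1 + i2 ∘ p2 = id1 Z ->
  @injective_obj C I -> @injective_obj C J -> @injective_obj C Z.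
Proof.
move=> e iI iJ X Y f g mf.
have [h1 e1] := iI X Y f (p1 ∘ g) mf; have [h2 e2] := iJ X Y f (p2 ∘ g) mf.
exists (i1 ∘ h1 + i2 ∘ h2); rewrite /= in e1 e2 *.
by rewrite pcompDl -!pcompA e1 e2 !pcompA -pcompDl e pcomp1m.
Qed.

Lemma factors_injective_compl X Y Z (g : phom Y Z) (f : phom X Y) :
  fi f -> fi (g ∘ f).
Proof.
move=> [I [v [u [iI ->]]]]; exists I, (g ∘ v), u; split=> //=;
  by rewrite pcompA.
Qed.

Lemma factors_injective_compr X Y Z (g : phom Y Z) (f : phom X Y) :
  fi g -> fi (g ∘ f).
Proof.
move=> [I [v [u [iI ->]]]]; exists I, v, (u ∘ f); split=> //=;
  by rewrite pcompA.
Qed.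

Lemma factors_injective0 X Y : fi (0 : phom X Y).
Proof.
have [I [m [iI _]]] := frob_enough_injectives frobC X.
by exists I, (0 : phom _ _), m; split=> //=; rewrite pcomp0l.
Qed.

Lemma factors_injectiveN X Y (f : phom X Y) : fi f -> fi (- f).
Proof.
move=> [I [v [u [iI ->]]]]; exists I, (- v : phom _ _), u; split=> //=.
by rewrite pcompNl.
Qed.

Lemma factors_injectiveD X Y (f g : phom X Y) : fi f -> fi g -> fi (f + g).
Proof.
move=> [I [v [u [iI ->]]]] [J [w [z [iJ ->]]]].
have [Z [i1 [i2 [p1 [p2 [e11 e22 e12 e21 e]]]]]] := frob_biproducts frobC I J.
exists Z, (v ∘ p1 + w ∘ p2), (i1 ∘ u + i2 ∘ z); split.
  exact: injective_biproduct e iI iJ.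
rewrite /= pcompDr !pcompDl !pcompA -!(pcompA _ _ i1) -!(pcompA _ _ i2).
by rewrite e11 e22 e12 e21 !pcompm1 !pcomp0r !pcomp0l addr0 add0r.
Qed.

Lemma stably_equal_refl X Y (f : phom X Y) : stably_equal f f.
Proof. by rewrite /stably_equal subrr; exact: factors_injective0. Qed.

Lemma stably_equal_trans X Y (g f h : phom X Y) :
  stably_equal f g -> stably_equal g h -> stably_equal f h.
Proof.
by move=> fg gh; rewrite /stably_equal -(subrKA g); exact: factors_injectiveD.
Qed.

Lemma stably_equal_comp X Y Z (g g' : phom Y Z) (f f' : phom X Y) :
  stably_equal g g' -> stably_equal f f' -> stably_equal (g ∘ f) (g' ∘ f').
Proof.
move=> gg ff; apply: (@stably_equal_trans _ _ (g ∘ f')).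
  by rewrite /stably_equal -pcompBr; exact: factors_injective_compl.
by rewrite /stably_equal -pcompBl; exact: factors_injective_compr.
Qed.

Lemma stably_equal_compl X Y Z (g : phom Y Z) (f f' : phom X Y) :
  stably_equal f f' -> stably_equal (g ∘ f) (g ∘ f').
Proof. by apply: stably_equal_comp; exact: stably_equal_refl. Qed.

Lemma stably_equal_compr X Y Z (g g' : phom Y Z) (f : phom X Y) :
  stably_equal g g' -> stably_equal (g ∘ f) (g' ∘ f).
Proof.
by move=> gg; apply: stably_equal_comp => //; exact: stably_equal_refl.
Qed.

Local Notation sweq := (@stable_equivalence C _ _).

Lemma stable_equivalence_of_inverse X Y (f : phom X Y) (g : phom Y X) :
  stably_equal (g ∘ f) (id1 X) -> stably_equal (f ∘ g) (id1 Y) -> sweq f.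
Proof. by move=> gf fg; exists g. Qed.

Lemma stable_equivalence_id X : sweq (id1 X).
Proof.
by apply: (@stable_equivalence_of_inverse _ _ _ (id1 X)); rewrite pcomp1m;
  exact: stably_equal_refl.
Qed.

Lemma stable_equivalence_comp X Y Z (g : phom Y Z) (f : phom X Y) :
  sweq g -> sweq f -> sweq (g ∘ f).
Proof.
move=> [g' /= [g1 g2]] [f' /= [f1 f2]]; apply:
  (@stable_equivalence_of_inverse _ _ _ (f' ∘ g')).
  apply: stably_equal_trans f1; rewrite !pcompA -(pcompA f').
  by apply: stably_equal_compr; rewrite -[X in stably_equal _ X]pcompm1;
    exact: stably_equal_compl.
apply: stably_equal_trans g2; rewrite !pcompA -(pcompA g).
by apply: stably_equal_compr; rewrite -[X in stably_equal _ X]pcompm1;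
  exact: stably_equal_compl.
Qed.

Lemma stable_equivalence_cancell X Y Z (g : phom Y Z) (f : phom X Y) :
  sweq f -> sweq (g ∘ f) -> sweq g.
Proof.
move=> [f' /= [f1 f2]] [k /= [k1 k2]]; apply:
  (@stable_equivalence_of_inverse _ _ _ (f ∘ k)).
  apply: (@stably_equal_trans _ _ (f ∘ k ∘ g ∘ (f ∘ f'))).
    rewrite -{1}[f ∘ k ∘ g]pcompm1; rewrite /stably_equal -pcompBr;
      apply: factors_injective_compl.
    by rewrite -opprB; exact: factors_injectiveN.
  apply: stably_equal_trans f2; rewrite !pcompA; apply: stably_equal_compr.
  by rewrite -!pcompA -[X in stably_equal _ X]pcompm1 ;
    apply: stably_equal_compl.
by move: k2; rewrite pcompA.
Qed.

Lemma stable_equivalence_cancelr X Y Z (g : phom Y Z) (f : phom X Y) :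
  sweq g -> sweq (g ∘ f) -> sweq f.
Proof.
move=> [g' /= [g1 g2]] [k /= [k1 k2]]; apply:
  (@stable_equivalence_of_inverse _ _ _ (k ∘ g)).
  by move: k1; rewrite pcompA.
apply: (@stably_equal_trans _ _ (g' ∘ g ∘ (f ∘ (k ∘ g)))).
  rewrite -{1}[f ∘ (k ∘ g)]pcomp1m; rewrite /stably_equal -pcompBl;
    apply: factors_injective_compr.
  by rewrite -opprB; exact: factors_injectiveN.
apply: stably_equal_trans g1; rewrite -pcompA; apply: stably_equal_compl.
by rewrite !pcompA -[X in stably_equal _ X]pcomp1m; apply: stably_equal_compr.
Qed.

(** Let g be a stable inverse of i, with g i - 1 = v u through an injective
    object. Extending u along i, the map g can be corrected within its stable
    class to a true retraction. *)
Lemma mono_stable_equivalence_split A B (i : phom A B) :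
  @mono C A B i -> sweq i ->
  exists r : phom B A, r ∘ i = id1 A /\ fi (id1 B - i ∘ r).
Proof.
move=> mi [g /= [[I [v [u [iI /= gi]]]] ig]].
have [u' /= ui] := iI _ _ i u mi; exists (g - v ∘ u'); split.
  by rewrite pcompBl -pcompA ui -gi subKr.
rewrite pcompBr opprB addrCA addrC; apply: factors_injectiveD.
  by rewrite -opprB; exact: factors_injectiveN.
by rewrite pcompA; exists I, (i ∘ v), u'.
Qed.

(** Dually, with v lifted through p: this uses that the injective object
    through which p g - 1 factors is projective. *)
Lemma epi_stable_equivalence_split X Y (p : phom X Y) :
  @epi C X Y p -> sweq p ->
  exists s : phom Y X, p ∘ s = id1 Y /\ fi (id1 X - s ∘ p).
Proof.
move=> ep [g /= [gp [I [v [u [iI /= pg]]]]]].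
have [v' /= pv] := frob_injective_projective frobC iI v ep.
exists (g - v' ∘ u); split; first by rewrite pcompBr pcompA pv -pg subKr.
rewrite pcompBl opprB addrCA addrC; apply: factors_injectiveD.
  by rewrite -opprB; exact: factors_injectiveN.
by rewrite -pcompA; exists I, v', (u ∘ p).
Qed.

(** With r a retraction of i, the idempotent e = 1 - i r vanishes on A and
    factors as w z through an injective object J. Since J is projective, v w
    lifts along p to some l. The lift is u r + l z e. *)
Lemma trivial_mono_lifts A B X Y (i : phom A B) (p : phom X Y) :
  @mono C A B i -> sweq i -> @epi C X Y p -> @has_lift C A B X Y i p.
Proof.
move=> mi wi ep u v /= uv; have [r [ri [J [w [z [iJ /= e]]]]]] :=
  mono_stable_equivalence_split mi wi.
have [l pl] := frob_injective_projective frobC iJ (v ∘ w) ep.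
set e1 := id1 B - i ∘ r in e.
have ei : e1 ∘ i = 0 by rewrite pcompBl pcomp1m -pcompA ri pcompm1 subrr.
have ee : e1 ∘ e1 = e1 by rewrite {2}/e1 pcompBr pcompm1 pcompA ei pcomp0l
  subr0.
exists (u ∘ r + l ∘ z ∘ e1); split=> /=.
  by rewrite pcompDl -!pcompA ri ei !pcomp0r pcompm1 addr0.
rewrite pcompDr !pcompA pl uv -!pcompA (pcompA w) -e ee -pcompDr.
by rewrite addrC subrK pcompm1.
Qed.

(** With s a section of p, the idempotent e = 1 - s p is killed by p and
    factors as w z through an injective object J. The map z u extends along i
    to some l. The lift is s v + e w l. *)
Lemma trivial_epi_lifts A B X Y (i : phom A B) (p : phom X Y) :
  @mono C A B i -> @epi C X Y p -> sweq p -> @has_lift C A B X Y i p.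
Proof.
move=> mi ep wp u v /= uv; have [s [ps [J [w [z [iJ /= e]]]]]] :=
  epi_stable_equivalence_split ep wp.
have [l /= li] := iJ _ _ i (z ∘ u) mi.
set e1 := id1 X - s ∘ p in e.
have pe : p ∘ e1 = 0 by rewrite pcompBr pcompm1 pcompA ps pcomp1m subrr.
have ee : e1 ∘ e1 = e1 by rewrite {1}/e1 pcompBl pcomp1m -pcompA pe pcomp0r
  subr0.
exists (s ∘ v + e1 ∘ w ∘ l); split=> /=.
  rewrite pcompDl -!pcompA li -uv !pcompA -(pcompA _ w) -e ee -pcompDl.
  by rewrite addrC subrK pcomp1m.
by rewrite pcompDr !pcompA ps pe pcomp1m !pcomp0l addr0.
Qed.

Lemma stable_equivalence_retract X Y X' Y' (f : phom X Y) (g : phom X' Y') :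
  @retract C X Y X' Y' f g -> sweq g -> sweq f.
Proof.
move=> [i [r [j [s /= [ri sj gi fr]]]]] [g' /= [g1 g2]].
apply: (@stable_equivalence_of_inverse _ _ _ (r ∘ g' ∘ j)).
  rewrite -pcompA -gi -pcompA (pcompA g').
  rewrite -[X in stably_equal _ X]ri; apply: stably_equal_compl.
  by rewrite -[X in stably_equal _ X]pcomp1m; exact: stably_equal_compr.
rewrite !pcompA fr -!pcompA (pcompA g).
rewrite -[X in stably_equal _ X]sj; apply: stably_equal_compl.
by rewrite -[X in stably_equal _ X]pcomp1m; exact: stably_equal_compr.
Qed.

(** An injective summand is invisible in the stable category. *)
Lemma biproduct_stable_equivalence X I Z (i1 : phom X Z) (i2 : phom I Z) p1 p2 :
  p1 ∘ i1 = id1 X -> i1 ∘ p1 + i2 ∘ p2 = id1 Z -> @injective_obj C I ->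
  sweq i1 /\ sweq p1.
Proof.
move=> pi e iI.
have ip : stably_equal (i1 ∘ p1) (id1 Z).
  rewrite /stably_equal -e opprD addrA subrr sub0r; apply: factors_injectiveN.
  by exists I, i2, p2.
by split; [apply: (@stable_equivalence_of_inverse _ _ _ p1) |
  apply: (@stable_equivalence_of_inverse _ _ _ i1)]; rewrite // pi;
  exact: stably_equal_refl.
Qed.

(** Lifting is [trivial_mono_lifts] and [trivial_epi_lifts]. To factor f : X ->
    Y, add to X a projective object P covering Y, which gives X -> X + P -> Y;
    or add to Y an injective object I containing X, which gives X -> Y + I ->
    Y. *)
Theorem frobenius_stable_model : is_model_structure (stable_model C).
Proof.
split.
- split; split=> [X|X Y Z g f] /=.
  + exact: stable_equivalence_id.
  + exact: stable_equivalence_comp.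
  + by move=> Z g h; rewrite /= !pcomp1m.
  + move=> mg mf T a b /=; rewrite -!pcompA => e; exact/mf/mg.
  + by move=> Z g h; rewrite /= !pcompm1.
  + move=> eg ef T a b /=; rewrite !pcompA => e; exact/eg/ef.
- move=> X Y Z g f; split; first by move=> wf wg;
    exact: stable_equivalence_comp.
    exact: stable_equivalence_cancell.
  exact: stable_equivalence_cancelr.
- split=> X Y X' Y' f g; first exact: stable_equivalence_retract.
    move=> [i [r [j [s /= [ri sj gi fr]]]]] mg Z a b /= e.
    have : i ∘ a = i ∘ b by apply: mg; rewrite /= !pcompA gi -!pcompA e.
    by move/(congr1 (pcomp r)); rewrite !pcompA ri !pcomp1m.
  move=> [i [r [j [s /= [ri sj gi fr]]]]] eg Z a b /= e.
  have : a ∘ s = b ∘ s by apply: eg; rewrite /= -!pcompA -fr !pcompA e.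
  by move/(congr1 (fun x => pcomp x j)); rewrite -!pcompA sj !pcompm1.
- by move=> A B X Y i p [mi wi] ep; exact: trivial_mono_lifts.
- by move=> A B X Y i p mi [ep wp]; exact: trivial_epi_lifts.
- move=> X Y f; have [P [e [iP ee]]] := frob_enough_projectives frobC Y.
  have [Z [i1 [i2 [p1 [p2 [e11 e22 e12 e21 eZ]]]]]] :=
    frob_biproducts frobC X P.
  exists Z, (f ∘ p1 + e ∘ p2), i1; split.
  + split; last by have [] := biproduct_stable_equivalence e11 eZ iP.
    by apply: mono_of_kernel => T g /(congr1 (pcomp p1));
      rewrite pcompA e11 pcomp1m pcomp0r.
  + apply: epi_of_cokernel => T g /(congr1 (fun x => pcomp x i2)).
    rewrite -pcompA pcompDl -!pcompA e12 e22 pcomp0r pcompm1 add0r pcomp0l =>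
      ge.
    by apply: ee; rewrite /= ge pcomp0l.
  + by rewrite /= pcompDl -!pcompA e11 e21 pcompm1 pcomp0r addr0.
- move=> X Y f; have [I [m [iI mm]]] := frob_enough_injectives frobC X.
  have [Z [i1 [i2 [p1 [p2 [e11 e22 e12 e21 eZ]]]]]] :=
    frob_biproducts frobC Y I.
  exists Z, p1, (i1 ∘ f + i2 ∘ m); split.
  + apply: mono_of_kernel => T g /(congr1 (pcomp p2)).
    rewrite pcompA pcompDr !pcompA e21 e22 pcomp0l pcomp1m add0r pcomp0r => ge.
    by apply: mm; rewrite /= ge pcomp0r.
  + split; last by have [] := biproduct_stable_equivalence e11 eZ iI.
    apply: epi_of_cokernel => T g /(congr1 (fun x => pcomp x i1)).
    by rewrite -pcompA e11 pcompm1 pcomp0l.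
  + by rewrite /= pcompDr !pcompA e11 e12 pcomp1m pcomp0l addr0.
Qed.
End Stable.
End Preadditive.

(** * Modules over the dual form a Frobenius category *)

Section HModFrobenius.
Variables (k : fieldType) (H : hopfAlgebra k).

Lemma dual_mul1l (x : hdual H) : dual_mul (dual_one H) x = x.
Proof.
apply/lfunP => h; rewrite dual_mulE -[in RHS](@counit_comull k H h).
rewrite (linear_tsum _ _ (@linear_lfun _ _ _ x)); apply: eq_tsum => a b.
by rewrite dual_oneE hdualZ.
Qed.

Lemma hit1 (h : H) : hit (dual_one H) h = h.
Proof. by have [_] := hit_actionP H. Qed.

Lemma hit_dual_mul x y (h : H) : hit (dual_mul x y) h = hit x (hit y h).
Proof. by have [_ _] := hit_actionP H. Qed.

Definition hmod_hom (X Y : hmodule H) (f : X -> Y) (lf : linear f)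
    (hf : hlinear f) :
  @phom (HMod H) X Y := exist _ f (conj lf hf).

Section Cofree.
Variable M : lmodType k.

Definition cofree_act (x : hdual H) (t : tensor M H) : tensor M H :=
  \tsum_(m, h <- t) m ⊗ hit x h.

Let bilinear_cofree x : is_bilinear (fun (m : M) (h : H) => m ⊗ hit x h).
Proof. by apply: (@bilinear_tens _ _ _ _ _ id) => //; exact: hit_linear. Qed.

Lemma cofree_act_linear x : linear (cofree_act x).
Proof. exact: (tsum_linear (bilinear_cofree x)). Qed.

Lemma cofree_act_tens x m h : cofree_act x (m ⊗ h) = m ⊗ hit x h.
Proof. exact: (tsum_tens _ _ (bilinear_cofree x)). Qed.

Lemma slice_cofree_act x y t :
  slice x (cofree_act y t) = slice (dual_mul x y) t.
Proof.
move: t; apply: tensor_linear_ext => [||m h].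
- by apply: linear_comp (cofree_act_linear y); exact: slice_linear.
- exact: slice_linear.
- by rewrite cofree_act_tens !slice_tens dual_mul_hit.
Qed.

Lemma cofree_actP : is_action cofree_act.
Proof.
split=> [|t|x y t].
- split=> [t|x]; last exact: cofree_act_linear.
  apply: linear_of_tsum => m h c x y; rewrite /hit slice_linearl.
  exact: linear_tensr.
- by rewrite -[RHS]tsum_tensE; apply: eq_tsum => m h; rewrite hit1.
- move: t; apply: tensor_linear_ext => [||m h]; first exact: cofree_act_linear.
    by apply: linear_comp; exact: cofree_act_linear.
  by rewrite !cofree_act_tens hit_dual_mul.
Qed.

(** The module M ⊗ H, with the dual acting on H. It is at once cofree, since H
    is the regular comodule, and free, since H is a free module of rank one;
    this is what makes injective and projective modules coincide. *)
Definition cofree : hmodule H := HModule cofree_actP.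

Section CofreeHom.
Variables (X : hmodule H) (f : X -> M).
Hypothesis lf : linear f.

(** The map v |-> f(v_(0)) ⊗ v_(1): module maps into the cofree module
    correspond to linear maps f : X -> M. *)
Definition cofree_fun (v : X) : cofree :=
  \tsum_(v0, v1 <- act_coact (@hact k H X) v) f v0 ⊗ v1.

Lemma slice_cofree_fun x v : slice x (cofree_fun v) = f (hact x v).
Proof.
rewrite (linear_tsum _ _ (slice_linear x)) -(slice_act_coact (hactP X)).
rewrite (linear_tsum _ _ lf); apply: eq_tsum => a b.
by rewrite slice_tens (linear_mapZ _ lf).
Qed.

Lemma cofree_fun_linear : linear cofree_fun.
Proof.
move=> c u v; apply: sliceP => x; rewrite slice_linear !slice_cofree_fun.
by have [[_ ar] _ _] := hactP X; rewrite ar lf.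
Qed.

Lemma cofree_fun_hlinear : hlinear cofree_fun.
Proof.
move=> y v; apply: sliceP => x; rewrite slice_cofree_act !slice_cofree_fun.
by have [_ _ ->] := hactP X.
Qed.

Definition cofree_hom := hmod_hom cofree_fun_linear cofree_fun_hlinear.

Lemma slice_counit_cofree_fun v : slice (dual_one H) (cofree_fun v) = f v.
Proof. by rewrite slice_cofree_fun; have [_ -> _] := hactP X. Qed.
End CofreeHom.
End Cofree.

Lemma injective_mono (X Y : hmodule H) (f : @phom (HMod H) X Y) :
  injective (sval f) -> @mono (HMod H) X Y f.
Proof.
move=> fI Z g h e; apply: lin_homP => z; apply: fI.
exact: (congr1 (fun a : @phom (HMod H) Z Y => sval a z) e).
Qed.

Lemma surjective_epi (X Y : hmodule H) (f : @phom (HMod H) X Y) :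
  (forall y, exists x, sval f x = y) -> @epi (HMod H) X Y f.
Proof.
move=> fS Z g h e; apply: lin_homP => y; have [x <-] := fS y.
exact: (congr1 (fun a : @phom (HMod H) X Z => sval a x) e).
Qed.

(** A module map that vanishes on the image of p is obtained without forming
    the cokernel: it is the map to a cofree module associated with a linear
    endomorphism of Y whose kernel is this image. *)
Lemma epi_surjective (X Y : hmodule H) (p : @phom (HMod H) X Y) :
  @epi (HMod H) X Y p -> forall y, exists x, sval p x = y.
Proof.
move=> ep; have [lp hp] := svalP p; pose S y := exists x, sval p x = y.
have [||q [lq q0 _]] := @exists_projection_along k Y S.
- by exists 0; exact: linear_map0 lp.
- by move=> c _ _ [x <-] [x' <-]; exists (c *: x + x'); rewrite lp.
suff qp0 : cofree_hom lq = (0 : @phom (HMod H) Y (cofree Y)).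
  move=> y; apply/q0; rewrite -(slice_counit_cofree_fun lq).
  rewrite -[cofree_fun _ _]/(sval (cofree_hom lq) y) qp0.
  exact: linear_map0 (slice_linear _).
apply: ep; apply: lin_homP => x; apply: sliceP => z /=.
rewrite (slice_cofree_fun lq) (linear_map0 (slice_linear _)).
by rewrite -hp; apply/q0; exists (hact z x).
Qed.

Section Frob.
Hypothesis frobH : cofrobenius H.

(** Each h is x acting on t for a unique x, denoted inv h; by uniqueness inv is
    linear over the dual. *)
Lemma exists_free_generator : exists (t : H) (inv : H -> hdual H),
  [/\ linear inv, forall h, hit (inv h) t = h, inv t = dual_one H
    & forall x h, inv (hit x h) = dual_mul x (inv h)].
Proof.
have [t [tI tS]] := regular_comodule_free frobH.
have [inv invP] := choice tS; exists t, inv.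
have hitI x y : hit x t = hit y t -> x = y.
  move=> e; apply/eqP; rewrite -subr_eq0; apply/eqP/tI.
  by rewrite /hit (linear_mapB (slice_linearl _)) -/(hit _ _) e subrr.
split=> [c u v|//||x h]; apply: hitI.
- by rewrite {2}/hit slice_linearl -!/(hit _ _) !invP.
- by rewrite invP hit1.
- by rewrite hit_dual_mul !invP.
Qed.

Section Free.
Variables (t : H) (inv : H -> hdual H).
Hypotheses (inv_lin : linear inv) (invK : forall h, hit (inv h) t = h)
  (inv_t : inv t = dual_one H)
  (inv_hit : forall x h, inv (hit x h) = dual_mul x (inv h)).

Section FreeHom.
Variables (M : lmodType k) (X : hmodule H) (f : M -> X).
Hypothesis lf : linear f.

(** Module maps out of the free module correspond to linear maps on its space
    of generators m ⊗ t. *)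
Definition free_fun (u : cofree M) : X := \tsum_(m, h <- u) hact (inv h) (f m).

Let bilinear_free : is_bilinear (fun (m : M) (h : H) => hact (inv h) (f m)).
Proof.
have [[al ar] _ _] := hactP X.
by split=> [h|m] c u v; rewrite ?lf ?ar // inv_lin al.
Qed.

Lemma free_fun_tens m h : free_fun (m ⊗ h) = hact (inv h) (f m).
Proof. exact: (tsum_tens _ _ bilinear_free). Qed.

Lemma free_fun_gen m : free_fun (m ⊗ t) = f m.
Proof. by rewrite free_fun_tens inv_t; have [_ ->] := hactP X. Qed.

Lemma free_fun_linear : linear free_fun.
Proof. exact: (tsum_linear bilinear_free). Qed.

Lemma free_fun_hlinear : hlinear free_fun.
Proof.
have [[_ ar] _ aM] := hactP X.
move=> x; apply: tensor_linear_ext => [||m h].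
- by apply: linear_comp free_fun_linear _; exact: cofree_act_linear.
- by apply: linear_comp free_fun_linear; exact: ar.
- by rewrite /= cofree_act_tens !free_fun_tens inv_hit aM.
Qed.

Definition free_hom := hmod_hom free_fun_linear free_fun_hlinear.
End FreeHom.

(** The free module on the vector space X maps to X through a linear retraction
    onto the kernel of p. Its composite with p is zero, so p being a
    monomorphism forces the retraction, hence the kernel, to vanish. *)
Lemma mono_injective (X Y : hmodule H) (p : @phom (HMod H) X Y) :
  @mono (HMod H) X Y p -> injective (sval p).
Proof.
move=> mp; have [lp hp] := svalP p; pose S x := sval p x = 0.
have [||q [lq q0 qS]] := @exists_projection_along k X S.
- exact: linear_map0.
- by move=> c x y Sx Sy; rewrite /S lp Sx Sy scaler0 addr0.
have lq' : linear (fun x => x - q x).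
  by move=> c x y; rewrite lq opprD addrACA -scalerBr.
have q'0 : free_hom lq' = (0 : @phom (HMod H) (cofree X) X).
  apply: mp; apply: lin_homP; apply: tensor_linear_ext => [||x h].
  - exact: linear_comp lp (free_fun_linear lq').
  - by apply: linear_comp lp _ => c x y; rewrite scaler0 addr0.
  - rewrite /= (free_fun_tens lq') hp qS (linear_map0 lp).
    by have [[_ ar] _ _] := hactP Y; rewrite (linear_map0 (ar _)).
have kerp x : sval p x = 0 -> x = 0.
  move=> /q0 qx; have := free_fun_gen lq' x.
  rewrite -[free_fun _ _]/(sval (free_hom lq') (x ⊗ t)) q'0 qx subr0.
  by move=> <-.
move=> x y e; apply/eqP; rewrite -subr_eq0; apply/eqP/kerp.
by rewrite (linear_mapB lp) e subrr.
Qed.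

(** By the cofree property this reduces to extending a linear map along an
    injective linear map. *)
Lemma cofree_injective M : @injective_obj (HMod H) (cofree M).
Proof.
move=> X Y g f mg; have [[lg hg] [lf hf]] := (svalP g, svalP f).
have le : linear (fun x => slice (dual_one H) (sval f x)).
  exact: linear_comp (slice_linear _) lf.
have [h lh hE] := injective_extension lg (mono_injective mg) le.
exists (cofree_hom lh); apply: lin_homP => v; apply: sliceP => x /=.
by rewrite (slice_cofree_fun lh) -hg hE hf slice_cofree_act dual_mul1l.
Qed.

(** By the free property this reduces to lifting a linear map along a
    surjective linear map. *)
Lemma cofree_projective M : projective_obj (C := HMod H) (cofree M).
Proof.
move=> X Y p f ep; have [[lp hp] [lf hf]] := (svalP p, svalP f).
have [s ls sK] := surjective_section lp (epi_surjective ep).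
have lg : linear (fun m : M => s (sval f (m ⊗ t))).
  by apply: (linear_comp ls); apply: linear_comp lf _; exact: linear_tensl.
exists (free_hom lg); apply: lin_homP; apply: tensor_linear_ext => [|//|m h].
  exact: linear_comp lp (free_fun_linear lg).
by rewrite /= (free_fun_tens lg) hp sK -hf /= cofree_act_tens invK.
Qed.

Lemma linear_id (V : lmodType k) : linear (@id V). Proof. by []. Qed.

Lemma cofree_unit_injective (X : hmodule H) :
  injective (sval (cofree_hom (@linear_id X))).
Proof.
move=> x y /(congr1 (slice (dual_one H))).
by rewrite !(slice_counit_cofree_fun (@linear_id _)).
Qed.

(** An injective module embeds into a cofree one, which is projective, and
    therefore is a retract of it. *)
Lemma hmod_injective_projective (I : hmodule H) :
  @injective_obj (HMod H) I -> projective_obj (C := HMod H) I.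
Proof.
move=> iI X Y p f ep.
have [r rE'] := iI _ _ _ (pidm _) (injective_mono (@cofree_unit_injective I)).
have rE : pcomp r (cofree_hom (@linear_id I)) = pidm (p := HMod H) I := rE'.
have [g gE] := cofree_projective (pcomp f r) ep.
exists (pcomp g (cofree_hom (@linear_id I))).
by rewrite pcompA gE -pcompA rE pcompm1.
Qed.

Lemma hmod_biproducts : has_biproducts (HMod H).
Proof.
move=> X Y; have [[xl xr] x1 xM] := hactP X; have [[yl yr] y1 yM] := hactP Y.
pose act (x : hdual H) (p : (X : lmodType k) * (Y : lmodType k)) :=
  (hact x p.1, hact x p.2).
have actP : is_action act.
  split=> [|p|x y p].
  - split=> [p|x] c u v; rewrite /act /=; first by rewrite xl yl.
    by rewrite xr yr.
  - by case: p => a b; rewrite /act /= x1 y1.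
  - by rewrite /act /= xM yM.
pose Z := HModule actP.
have li1 : linear ((fun x => (x, 0)) : X -> Z).
  by move=> c u v; congr (_, _); rewrite /= scaler0 addr0.
have hi1 : @hlinear k H X Z (fun x => (x, 0)).
  by move=> x m; congr (_, _); rewrite (linear_map0 (yr _)).
have li2 : linear ((fun y => (0, y)) : Y -> Z).
  by move=> c u v; congr (_, _); rewrite /= scaler0 addr0.
have hi2 : @hlinear k H Y Z (fun y => (0, y)).
  by move=> x m; congr (_, _); rewrite (linear_map0 (xr _)).
have lp1 : linear (fst : Z -> X) by [].
have hp1 : @hlinear k H Z X fst by [].
have lp2 : linear (snd : Z -> Y) by [].
have hp2 : @hlinear k H Z Y snd by [].
exists Z, (hmod_hom li1 hi1), (hmod_hom li2 hi2), (hmod_hom lp1 hp1),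
  (hmod_hom lp2 hp2).
by split; apply: lin_homP => //= -[a b]; congr (_, _);
  rewrite /= (add0r, addr0).
Qed.

Lemma hmod_frobenius_of_generator : frobenius (HMod H).
Proof.
split.
- exact: hmod_biproducts.
- move=> X; exists (cofree X), (cofree_hom (@linear_id X)); split.
    exact: cofree_injective.
  exact: injective_mono (@cofree_unit_injective X).
- move=> X; exists (cofree X), (free_hom (@linear_id X)); split.
    exact: cofree_injective.
  apply: surjective_epi => x; exists (x ⊗ t);
    exact: (free_fun_gen (@linear_id X)).
- exact: hmod_injective_projective.
Qed.
End Free.

Theorem hmod_frobenius : frobenius (HMod H).
Proof.
have [t [inv [inv_lin invK inv_t inv_hit]]] := exists_free_generator.
exact: hmod_frobenius_of_generator inv_lin invK inv_t inv_hit.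
Qed.
End Frob.
End HModFrobenius.

(** * Equivalences, adjoints and transport of model structures *)

Section UniversalArrows.

(** The universal property of the unit of an adjunction at X. *)
Definition universal_arrow (C D : category) (U : functor D C)
    (X : obj C) (A : obj D) (e : hom X (U A)) :=
  forall (B : obj D) (g : hom X (U B)), exists h : hom A B, fmap U h \c e = g /\
    forall h' : hom A B, fmap U h' \c e = g -> h' = h.

Definition has_universal_arrows (C D : category) (U : functor D C) :=
  forall X : obj C, exists (A : obj D) (e : hom X (U A)), universal_arrow e.

Section ChosenArrows.
Variables (C D : category) (U : functor D C).
Variables (F0 : obj C -> obj D) (e : forall X, hom X (U (F0 X))).
Variable ext : forall (X : obj C) (B : obj D), hom X (U B) -> hom (F0 X) B.
Hypothesis extE : forall X B (g : hom X (U B)), fmap U (ext g) \c e X = g.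
Hypothesis extU : forall X B (h h' : hom (F0 X) B),
  fmap U h \c e X = fmap U h' \c e X -> h = h'.

Let F1 (X Y : obj C) (f : hom X Y) : hom (F0 X) (F0 Y) := ext (e Y \c f).

Let F1E (X Y : obj C) (f : hom X Y) : fmap U (F1 f) \c e X = e Y \c f.
Proof. exact: extE. Qed.

Let F11 X : F1 (idm X) = idm (F0 X).
Proof. by apply: extU; rewrite (F1E (idm X)) fmap1 compm1 comp1m. Qed.

Let F1M X Y Z (g : hom Y Z) (f : hom X Y) : F1 (g \c f) = F1 g \c F1 f.
Proof.
apply: extU; rewrite (F1E (g \c f)) fmap_comp -compA (F1E f).
by rewrite [RHS]compA (F1E g) compA.
Qed.

Definition ext_functor : functor C D := Functor F11 F1M.

Definition ext_adjunction : adjunction ext_functor U.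
Proof.
pose eps Y : hom (F0 (U Y)) Y := ext (idm (U Y)).
have epsE Y : fmap U (eps Y) \c e (U Y) = idm (U Y) by exact: extE.
apply: (@Adjunction _ _ ext_functor U e eps) => [X X' f|Y Y' g|X|Y] /=.
- by rewrite (F1E f).
- apply: extU; rewrite !fmap_comp -!compA (F1E (fmap U g)) (epsE Y).
  by rewrite [LHS]compA (epsE Y') comp1m compm1.
- by apply: extU; rewrite fmap_comp -compA (F1E (e X)) [LHS]compA (epsE (F0 X))
    fmap1 comp1m.
- exact: epsE.
Qed.
End ChosenArrows.

Lemma left_adjoint_of_universal_arrows (C D : category) (U : functor D C) :
  has_universal_arrows U -> exists F : functor C D, inhabited (adjunction F U).
Proof.
move=> ua.
pose F0 X : obj D := sval (cid (ua X)).
pose e X : hom X (U (F0 X)) := sval (cid (svalP (cid (ua X)))).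
have eP X : universal_arrow (e X) by exact: svalP (cid (svalP (cid (ua X)))).
pose ext X B (g : hom X (U B)) : hom (F0 X) B := sval (cid (eP X B g)).
have extE X B (g : hom X (U B)) : fmap U (ext X B g) \c e X = g.
  by have [] := svalP (cid (eP X B g)).
have extU X B (h h' : hom (F0 X) B) : fmap U h \c e X = fmap U h' \c e X -> h =
  h'.
  move=> hh; have [_ u] := svalP (cid (eP X B (fmap U h' \c e X))).
  by rewrite (u h hh) -(u h' erefl).
by exists (ext_functor extE extU); constructor; exact: ext_adjunction.
Qed.

Lemma universal_arrows_comp (C D E : category) (U : functor D C)
    (V : functor E D) :
  has_universal_arrows U -> has_universal_arrows V ->
  has_universal_arrows (functor_comp U V).
Proof.
move=> uU uV X; have [A [e eP]] := uU X; have [B [d dP]] := uV A.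
exists B, (fmap U d \c e) => Z g; have [h [hE hU]] := eP _ g;
  have [l [lE lU]] := dP _ h.
exists l; split=> [|l' l'E]; first by rewrite /= compA -fmap_comp lE.
by apply/lU/hU; rewrite fmap_comp -compA.
Qed.
End UniversalArrows.

Section Equivalence.
Variables (C D : category) (F : functor C D).

Record equivalence : Prop := IsEquivalence {
  equiv_full : forall (X Y : obj C) (g : hom (F X) (F Y)),
    exists f, fmap F f = g;
  equiv_faithful : forall (X Y : obj C) (f g : hom X Y),
    fmap F f = fmap F g -> f = g;
  equiv_surj : forall Y : obj D,
    exists (X : obj C) (a : hom (F X) Y) (b : hom Y (F X)),
    a \c b = idm Y /\ b \c a = idm (F X)
}.

Hypothesis eqF : equivalence.

Lemma equivalence_universal_arrows : has_universal_arrows F.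
Proof.
move=> Y; have [X [a [b [ab ba]]]] := equiv_surj eqF Y.
exists X, b => B g; have [f fE] := equiv_full eqF (g \c a).
exists f; split; first by rewrite fE -compA ab compm1.
move=> f' f'E; apply: (equiv_faithful eqF).
by rewrite fE -f'E -compA ba compm1.
Qed.

(** Up to isomorphism every object of D is in the image of F, so universality
    of an arrow may be tested on this image. *)
Lemma universal_arrows_cancel (B : category) (U : functor D B) :
  has_universal_arrows (functor_comp U F) -> has_universal_arrows U.
Proof.
move=> ua X; have [A [e eP]] := ua X; exists (F A), e => Y g.
have [Z [a [b [ab ba]]]] := equiv_surj eqF Y.
have [h [hE hU]] := eP Z (fmap U b \c g).
exists (a \c fmap F h); split.
  rewrite fmap_comp -compA.
  have {}hE : fmap U (fmap F h) \c e = fmap U b \c g := hE.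
  by rewrite hE compA -fmap_comp ab fmap1 comp1m.
move=> l lE; have [l' l'E] := equiv_full eqF (b \c l).
suff <- : l' = h by rewrite l'E compA ab comp1m.
by apply: hU; rewrite /= l'E fmap_comp -compA lE.
Qed.

(** A quasi-inverse G, chosen objectwise with the isomorphisms a and b between
    F (G Y) and Y, is right adjoint to F, with a as counit. *)
Lemma equivalence_right_adjoint :
  exists G : functor D C, inhabited (adjunction F G).
Proof.
have surj := equiv_surj eqF.
pose G0 Y : obj C := sval (cid (surj Y)).
pose a Y : hom (F (G0 Y)) Y := sval (cid (svalP (cid (surj Y)))).
pose b Y : hom Y (F (G0 Y)) := sval (cid (svalP (cid (svalP (cid (surj Y)))))).
have ab Y : a Y \c b Y = idm Y.
  by have [] := svalP (cid (svalP (cid (svalP (cid (surj Y)))))).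
have ba Y : b Y \c a Y = idm _.
  by have [] := svalP (cid (svalP (cid (svalP (cid (surj Y)))))).
pose inv X Y (g : hom (F X) (F Y)) : hom X Y := sval (cid (equiv_full eqF g)).
have invK X Y (g : hom (F X) (F Y)) : fmap F (inv X Y g) = g.
  exact: svalP (cid (equiv_full eqF g)).
pose G1 X Y (g : hom X Y) : hom (G0 X) (G0 Y) := inv _ _ (b Y \c g \c a X).
have G11 X : G1 X X (idm X) = idm (G0 X).
  by apply: (equiv_faithful eqF); rewrite invK compm1 ba fmap1.
have G1M X Y Z (g : hom Y Z) (f : hom X Y) : G1 _ _ (g \c f) =
  G1 _ _ g \c G1 _ _ f.
  apply: (equiv_faithful eqF); rewrite fmap_comp !invK.
  by rewrite !compA -(compA _ (a Y)) ab compm1.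
pose G := Functor G11 G1M; exists G; constructor.
apply: (@Adjunction _ _ F G (fun X => inv X (G0 (F X)) (b (F X))) a) =>
  [X X' f|Y Y' g|X|Y].
- apply: (equiv_faithful eqF); rewrite !fmap_comp !invK.
  by rewrite -!compA ab compm1.
- by rewrite /= invK !compA ab comp1m.
- by rewrite invK ab.
- apply: (equiv_faithful eqF); rewrite fmap_comp !invK fmap1.
  by rewrite -!compA ab compm1 ba.
Qed.

Lemma equivalence_left_adjoint :
  exists G : functor D C, inhabited (adjunction G F).
Proof.
exact: left_adjoint_of_universal_arrows equivalence_universal_arrows.
Qed.

Lemma fmap_mono (X Y : obj C) (f : hom X Y) : mono f <-> mono (fmap F f).
Proof.
split=> mf Z g h e.
  have [W [a [b [ab ba]]]] := equiv_surj eqF Z.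
  have [[g' gE] [h' hE]] := (equiv_full eqF (g \c a), equiv_full eqF (h \c a)).
  have gh : g' = h'.
    apply: mf; apply: (equiv_faithful eqF).
    by rewrite !fmap_comp gE hE !compA e.
  have : g \c a = h \c a by rewrite -gE -hE gh.
  by move/(congr1 (fun x => x \c b)); rewrite -!compA ab !compm1.
by apply: (equiv_faithful eqF); apply: mf; rewrite -!fmap_comp e.
Qed.

Lemma fmap_epi (X Y : obj C) (f : hom X Y) : epi f <-> epi (fmap F f).
Proof.
split=> ef Z g h e.
  have [W [a [b [ab ba]]]] := equiv_surj eqF Z.
  have [[g' gE] [h' hE]] := (equiv_full eqF (b \c g), equiv_full eqF (b \c h)).
  have gh : g' = h'.
    apply: ef; apply: (equiv_faithful eqF).
    by rewrite !fmap_comp gE hE -!compA e.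
  have : b \c g = b \c h by rewrite -gE -hE gh.
  by move/(congr1 (fun x => a \c x)); rewrite !compA ab !comp1m.
by apply: (equiv_faithful eqF); apply: ef; rewrite -!fmap_comp e.
Qed.

Lemma mono_comp (E : category) (X Y Z : obj E) (g : hom Y Z) (f : hom X Y) :
  mono g -> mono f -> mono (g \c f).
Proof. by move=> mg mf T u v; rewrite -!compA => e; apply/mf/mg. Qed.

Lemma split_mono (E : category) (X Y : obj E) (r : hom Y X) (f : hom X Y) :
  r \c f = idm X -> mono f.
Proof.
move=> rf T u v e; rewrite -(comp1m u) -(comp1m v) -rf.
by rewrite -!compA e.
Qed.

Lemma fmap_injective (I : obj C) : injective_obj I <-> injective_obj (F I).
Proof.
split=> iI X Y f g mf.
  have [X' [aX [bX [abX baX]]]] := equiv_surj eqF X.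
  have [Y' [aY [bY [abY baY]]]] := equiv_surj eqF Y.
  have [f' fE] := equiv_full eqF (bY \c f \c aX).
  have [g' gE] := equiv_full eqF (g \c aX).
  have mf' : mono f'.
    apply/fmap_mono; rewrite fE; apply: mono_comp; last exact: split_mono baX.
    by apply: mono_comp => //; exact: split_mono abY.
  have [h hE] := iI _ _ f' g' mf'.
  exists (fmap F h \c bY).
  have : fmap F h \c fmap F f' \c bX = g.
    by rewrite -fmap_comp hE gE -compA abX compm1.
  by rewrite fE -!compA abX compm1.
have [h hE] := iI _ _ (fmap F f) (fmap F g) ((fmap_mono f).1 mf).
have [h' h'E] := equiv_full eqF h; exists h'.
by apply: (equiv_faithful eqF); rewrite fmap_comp h'E.
Qed.

Lemma fmap_has_lift (A B X Y : obj C) (i : hom A B) (p : hom X Y) :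
  has_lift (fmap F i) (fmap F p) -> has_lift i p.
Proof.
move=> l u v e; have [|h [h1 h2]] := l (fmap F u) (fmap F v).
  by rewrite -!fmap_comp e.
have [h' h'E] := equiv_full eqF h.
by exists h'; split; apply: (equiv_faithful eqF); rewrite fmap_comp h'E.
Qed.

Lemma fmap_retract (X Y X' Y' : obj C) (f : hom X Y) (g : hom X' Y') :
  retract f g -> retract (fmap F f) (fmap F g).
Proof.
move=> [i [r [j [s [ri sj gi fr]]]]].
exists (fmap F i), (fmap F r), (fmap F j), (fmap F s).
by split; rewrite -!fmap_comp ?fmap1 ?ri ?sj ?gi ?fr ?fmap1.
Qed.

Section Transport.
Variables (MC : model_classes C) (MD : model_classes D).

Record same_classes : Prop := SameClasses {
  same_weq : forall (X Y : obj C) (f : hom X Y), weq MC f <-> weq MD (fmap F f);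
  same_cof : forall (X Y : obj C) (f : hom X Y), cof MC f <-> cof MD (fmap F f);
  same_fib : forall (X Y : obj C) (f : hom X Y), fib MC f <-> fib MD (fmap F f)
}.

Hypothesis sameF : same_classes.

Let weqE (X Y : obj C) (f : hom X Y) : weq MC f = weq MD (fmap F f).
Proof. exact/propext/same_weq. Qed.
Let cofE (X Y : obj C) (f : hom X Y) : cof MC f = cof MD (fmap F f).
Proof. exact/propext/same_cof. Qed.
Let fibE (X Y : obj C) (f : hom X Y) : fib MC f = fib MD (fmap F f).
Proof. exact/propext/same_fib. Qed.
Let sE := (weqE, cofE, fibE).

Lemma iso_retractr (Z Z' Y : obj D) (p : hom Z Y)
    (a : hom Z' Z) (b : hom Z Z') :
  a \c b = idm Z -> b \c a = idm Z' -> retract (p \c a) p.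
Proof.
move=> ab ba; exists a, b, (idm Y), (idm Y).
by rewrite !comp1m -compA ab compm1.
Qed.

Lemma iso_retractl (X Z Z' : obj D) (i : hom X Z)
    (a : hom Z' Z) (b : hom Z Z') :
  a \c b = idm Z -> b \c a = idm Z' -> retract (b \c i) i.
Proof.
move=> ab ba; exists (idm X), (idm X), a, b.
by rewrite !compm1 compA ab comp1m.
Qed.

(** A factorization of F f in D is brought back to C by replacing the middle
    object by an isomorphic one in the image of F; closure under retracts gives
    invariance of both classes under this isomorphism. *)
Lemma factor_through_equivalence (P Q : forall X Y : obj D, hom X Y -> Prop) :
  retract_closed P -> retract_closed Q -> forall (X Y : obj C) (f : hom X Y),
  (exists Z (p : hom Z (F Y)) (i : hom (F X) Z),
    [/\ P _ _ i, Q _ _ p & p \c i = fmap F f]) ->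
  exists (Z : obj C) (p : hom Z Y) (i : hom X Z),
    [/\ P _ _ (fmap F i), Q _ _ (fmap F p) & p \c i = f].
Proof.
move=> rP rQ X Y f [Z [p [i [Pi Qp pi]]]].
have [W [a [b [ab ba]]]] := equiv_surj eqF Z.
have [[p' pE] [i' iE]] := (equiv_full eqF (p \c a), equiv_full eqF (b \c i)).
exists W, p', i'; split.
- by rewrite iE; apply: rP Pi; exact: iso_retractl ab ba.
- by rewrite pE; apply: rQ Qp; exact: iso_retractr ab ba.
- apply: (equiv_faithful eqF); rewrite fmap_comp pE iE -compA (compA a) ab.
  by rewrite comp1m.
Qed.

Lemma retract_closed_and (E : category)
    (P Q : forall X Y : obj E, hom X Y -> Prop) :
  retract_closed P -> retract_closed Q ->
  retract_closed (fun X Y (f : hom X Y) => P _ _ f /\ Q _ _ f).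
Proof.
by move=> rP rQ X Y X' Y' f g fg [Pg Qg]; split;
  [exact: rP fg Pg | exact: rQ fg Qg].
Qed.

Lemma transport_model : is_model_structure MD -> is_model_structure MC.
Proof.
move=> [[[w1 w2] [c1 c2] [f1 f2]] t23 [rw rc rf] ltc ltf ftc ftf].
split.
- split; split=> [X|X Y Z g f]; rewrite !sE ?fmap1 ?fmap_comp;
    by [exact: w1 | exact: w2 | exact: c1 | exact: c2 | exact: f1 | exact: f2].
- by move=> X Y Z g f; have := t23 _ _ _ (fmap F g) (fmap F f);
    rewrite !sE fmap_comp.
- split=> X Y X' Y' f g /fmap_retract; rewrite !sE;
    by [exact: rw | exact: rc | exact: rf].
- move=> A B X Y i p [ci wi] fp; apply: fmap_has_lift; apply: ltc;
    last by rewrite -fibE.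
  by split; [rewrite -cofE | rewrite -weqE].
- move=> A B X Y i p ci [fp wp]; apply: fmap_has_lift; apply: ltf;
    first by rewrite -cofE.
  by split; [rewrite -fibE | rewrite -weqE].
- move=> X Y f.
  have [Z [p [i [[ci wi] fp pi]]]] :=
    factor_through_equivalence (retract_closed_and rc rw) rf
      (ftc _ _ (fmap F f)).
  by exists Z, p, i; rewrite /trivial_cof !sE.
- move=> X Y f.
  have [Z [p [i [ci [fp wp] pi]]]] :=
    factor_through_equivalence rc (retract_closed_and rf rw)
      (ftf _ _ (fmap F f)).
  by exists Z, p, i; rewrite /trivial_fib !sE.
Qed.

Lemma equivalence_left_quillen : left_quillen MC MD F.
Proof.
split; first exact: equivalence_right_adjoint.
  by move=> X Y f; rewrite sE.
by move=> X Y f; rewrite /trivial_cof !sE.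
Qed.

Lemma equivalence_right_quillen : right_quillen MC MD F.
Proof.
split; first exact: equivalence_left_adjoint.
  by move=> X Y f; rewrite sE.
by move=> X Y f; rewrite /trivial_fib !sE.
Qed.
End Transport.

Section Induced.
Variables (C0 D0 : category) (UC : functor C C0) (UD : functor D D0).
Variables (M0C : model_classes C0) (M0D : model_classes D0).
Hypothesis weq_same : forall (X Y : obj C) (f : hom X Y),
  weq M0C (fmap UC f) <-> weq M0D (fmap UD (fmap F f)).
Hypothesis fib_same : forall (X Y : obj C) (f : hom X Y),
  fib M0C (fmap UC f) <-> fib M0D (fmap UD (fmap F f)).

(** The cofibrations are defined by a lifting property against trivial
    fibrations, and up to isomorphism each trivial fibration of D is the image
    of one of C. *)
Lemma right_induced_same_classes :
  retract_closed (@weq D (right_induced M0D UD)) ->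
  retract_closed (@fib D (right_induced M0D UD)) ->
  same_classes (right_induced M0C UC) (right_induced M0D UD).
Proof.
move=> rw rf; split=> // A B i; split=> /= li X Y p [fp wp]; last first.
  by apply: fmap_has_lift; apply: li; split; [exact/fib_same | exact/weq_same].
have [X' [aX [bX [abX baX]]]] := equiv_surj eqF X.
have [Y' [aY [bY [abY baY]]]] := equiv_surj eqF Y.
have [p' pE] := equiv_full eqF (bY \c p \c aX).
have rp : retract (fmap F p') p.
  exists aX, bX, aY, bY; rewrite pE; split=> //.
    by rewrite !compA abY comp1m.
  by rewrite -!compA abX compm1.
move=> u v uv.
have [[u' uE] [v' vE]] := (equiv_full eqF (bX \c u), equiv_full eqF (bY \c v)).
have [||h [h1 h2]] := li X' Y' p' _ u' v'.
- by split; [apply/fib_same; exact: rf rp fp | apply/weq_same; exact: rw rp wp].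
- apply: (equiv_faithful eqF); rewrite !fmap_comp pE uE vE.
  by rewrite -!compA (compA aX) abX comp1m uv.
exists (aX \c fmap F h); split.
  by rewrite -compA -fmap_comp h1 uE compA abX comp1m.
have : aY \c fmap F (p' \c h) = v by rewrite h2 vE compA abY comp1m.
by rewrite fmap_comp pE !compA abY comp1m.
Qed.
End Induced.
End Equivalence.

Section StableTransport.
Variables (C D : preadditive) (F : functor C D).
Hypothesis eqF : equivalence F.
Hypothesis F_B : forall (X Y : pobj C) (f g : phom X Y),
  (fmap F (f - g : phom X Y) : phom _ _) =
    (fmap F f : phom _ _) - (fmap F g : phom _ _).

Lemma fmap_factors_injective (X Y : obj C) (f : hom X Y) :
  factors_injective f <-> factors_injective (fmap F f).
Proof.
split=> [[I [v [u [iI ->]]]]|[J [v [u [iJ e]]]]].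
  exists (F I), (fmap F v), (fmap F u); split; first exact/(fmap_injective eqF).
  by rewrite fmap_comp.
have [I [a [b [ab ba]]]] := equiv_surj eqF J.
have [[v' vE] [u' uE]] := (equiv_full eqF (v \c a), equiv_full eqF (b \c u)).
exists I, v', u'; split.
  (* F I is injective since it is isomorphic to J. *)
  apply/(fmap_injective eqF) => Z W g h mg; have [l lE] := iJ _ _ g (a \c h) mg.
  by exists (b \c l); rewrite -compA lE compA ba comp1m.
apply: (equiv_faithful eqF); rewrite fmap_comp vE uE -compA (compA a) ab comp1m.
exact: e.
Qed.

Lemma fmap_stable_equivalence (X Y : obj C) (f : hom X Y) :
  stable_equivalence f <-> stable_equivalence (fmap F f).
Proof.
have eqv (Z W : obj C) (g h : hom Z W) :
    stably_equal g h <-> stably_equal (fmap F g : phom _ _) (fmap F h).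
  by rewrite /stably_equal -F_B; exact: fmap_factors_injective.
split=> [[g [gf fg]]|[g [gf fg]]].
  by exists (fmap F g); rewrite -!fmap_comp -!fmap1; split; apply/eqv.
have [g' gE] := equiv_full eqF g; exists g'.
by split; apply/eqv; rewrite fmap_comp fmap1 gE.
Qed.

Lemma stable_same_classes : same_classes F (stable_model C) (stable_model D).
Proof.
split=> X Y f; [exact: fmap_stable_equivalence | exact: fmap_mono |
  exact: fmap_epi].
Qed.
End StableTransport.

(** * Free modules over a comodule algebra *)

(** Proves the linearity of a sum of pure tensors in one of its variables. The
    tensor rules are run twice because a scalar or a sum may come out of a
    nested tensor product. *)
Ltac multilinear :=
  intros; repeat (apply: linear_of_tsum => ? ?); move=> ? ? ?;
  rewrite ?mulrDl ?mulrDr -?scalerAl -?scalerAr ?tensorDl ?tensorDr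
    ?tensorZl ?tensorZr ?tensorDl ?tensorDr ?tensorZl ?tensorZr //.

Section Diagonal.
Variables (k : fieldType) (H : hopfAlgebra k).

Lemma bilinear_tsum2 (M N M' N' U : lmodType k) (r : M -> tensor M' H)
    (s : N -> tensor N' H) (Q : M' -> H -> N' -> H -> U) :
  linear r -> linear s ->
  (forall n h, is_bilinear (fun m g => Q m g n h)) ->
  (forall m g, is_bilinear (Q m g)) ->
  is_bilinear (fun m n =>
    \tsum_(m0, m1 <- r m) \tsum_(n0, n1 <- s n) Q m0 m1 n0 n1).
Proof.
move=> lr ls Ql Qr; split=> [n|m].
  under [fun _ => _]funext do rewrite exchange_tsum.
  apply: linear_of_tsum => n0 n1; exact: linear_tsum_comp (Ql n0 n1) lr.
apply: linear_of_tsum => m0 m1; exact: linear_tsum_comp (Qr m0 m1) ls.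
Qed.

Section Tensor.
Variables M N : comodule H.

(** The diagonal coaction on a pure tensor. *)
Definition diag_tens (m : M) (n : N) : tensor (tensor M N) H :=
  \tsum_(m0, m1 <- coact m) \tsum_(n0, n1 <- coact n) (m0 ⊗ n0) ⊗ (m1 * n1).

Lemma diag_tens_bilinear : is_bilinear diag_tens.
Proof.
have [[lM _ _] [lN _ _]] := (coactP M, coactP N).
by apply: bilinear_tsum2 => // *; split; multilinear.
Qed.

Definition diag_coact (t : tensor M N) := tsum diag_tens t.

Lemma diag_coact_tens m n : diag_coact (m ⊗ n) = diag_tens m n.
Proof. exact: (tsum_tens _ _ diag_tens_bilinear). Qed.

Lemma diag_coact_linear : linear diag_coact.
Proof. exact: (tsum_linear diag_tens_bilinear). Qed.

Lemma linear_tsum_diag (U : lmodType k) (b : tensor M N -> H -> U) m n :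
  is_bilinear b ->
  tsum b (diag_tens m n) =
  \tsum_(m0, m1 <- coact m) \tsum_(n0, n1 <- coact n) b (m0 ⊗ n0) (m1 * n1).
Proof.
move=> bb; rewrite (linear_tsum _ _ (tsum_linear bb)); apply: eq_tsum => m0 m1.
rewrite (linear_tsum _ _ (tsum_linear bb)); apply: eq_tsum => n0 n1.
exact: tsum_tens.
Qed.

(** Coassociativity is that of M and N applied one after the other, together
    with the multiplicativity of the coproduct. *)
Lemma diag_coactP : is_coaction diag_coact.
Proof.
have [[lM _ M1] [lN _ N1]] := (coactP M, coactP N).
have bl : is_bilinear (fun (t : tensor M N) (h : H) =>
    \tsum_(t0, t1 <- diag_coact t) t0 ⊗ (t1 ⊗ h)).
  split=> [h|t]; last by multilinear.
  apply: linear_tsum_comp diag_coact_linear.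
  by split; multilinear.
have br : is_bilinear (fun (t : tensor M N) (h : H) =>
    \tsum_(h1, h2 <- comul h) t ⊗ (h1 ⊗ h2)).
  split=> [h|t]; first by multilinear.
  apply: linear_tsum_comp (@comul_linear k H).
  by split; multilinear.
have bc := coact_act_bilinear (tensor M N) (dual_one H).
split; first exact: diag_coact_linear.
- apply: tensor_linear_ext => [||m n].
  + exact: linear_tsum_comp bl diag_coact_linear.
  + exact: linear_tsum_comp br diag_coact_linear.
  rewrite !diag_coact_tens !linear_tsum_diag //.
  pose Phi m0 (g h : H) n0 (g' h' : H) : tensor (tensor M N) (tensor H H) :=
    (m0 ⊗ n0) ⊗ ((g * g') ⊗ (h * h')).
  transitivity (\tsum_(m0, m1 <- coact m) \tsum_(m00, m01 <- coact m0)
    \tsum_(n0, n1 <- coact n) \tsum_(n00, n01 <- coact n0) Phi m00 m01 m1 n00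
      n01 n1).
    apply: eq_tsum => m0 m1; rewrite [RHS]exchange_tsum;
      apply: eq_tsum => n0 n1.
    by rewrite diag_coact_tens linear_tsum_diag //; split; multilinear.
  rewrite (coact_coassoc _ (coactP M)); last by split; rewrite /Phi;
    multilinear.
  transitivity (\tsum_(m0, m1 <- coact m) \tsum_(g, h <- comul m1)
    \tsum_(n0, n1 <- coact n) \tsum_(g', h' <- comul n1) Phi m0 g h n0 g' h').
    apply: eq_tsum => m0 m1; apply: eq_tsum => g h.
    by apply: (coact_coassoc _ (coactP N)); split; rewrite /Phi; multilinear.
  apply: eq_tsum => m0 m1; rewrite exchange_tsum; apply: eq_tsum => n0 n1.
  rewrite comulM (linear_tsum _ _ (tsum_linear _)); last by split; multilinear.
  apply: eq_tsum => g h; rewrite (linear_tsum _ _ (tsum_linear _));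
    last by split; multilinear.
  by apply: eq_tsum => g' h'; rewrite tsum_tens //; split; multilinear.
- have lc : linear (fun t => slice (dual_one H) (diag_coact t)).
    exact: linear_comp (slice_linear _) diag_coact_linear.
  have e : forall t, slice (dual_one H) (diag_coact t) = t.
    apply: tensor_linear_ext => // m n; rewrite diag_coact_tens /slice
      linear_tsum_diag //.
    rewrite -[in RHS](M1 m) (linear_tsum _ _ (linear_tensl n)).
    apply: eq_tsum => m0 m1; rewrite -[in RHS](N1 n).
    rewrite (linear_tsum _ _ (linear_tensr _)); apply: eq_tsum => n0 n1.
    by rewrite dual_oneE (@counitM k H) tensorZl tensorZr scalerA.
  by move=> t; rewrite -[RHS]e; apply: eq_tsum => v h; rewrite dual_oneE.
Qed.

Definition diag_comod : comodule H := Comodule diag_coactP.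

Lemma colinear2_tsum (P : comodule H) (b : M -> N -> P) :
  is_bilinear b -> colinear2 b -> @colinear k H diag_comod P (tsum b).
Proof.
move=> bb cb; have [lP _ _] := coactP P.
have bt : is_bilinear (fun (t : diag_comod) (h : H) => tsum b t ⊗ h).
  by apply: (@bilinear_tens _ _ _ _ _ (tsum b) id) => //; exact: tsum_linear.
apply: tensor_linear_ext => [||m n].
- by apply: linear_comp lP _; exact: tsum_linear.
- exact: linear_tsum_comp bt diag_coact_linear.
rewrite tsum_tens // cb /= diag_coact_tens linear_tsum_diag //.
by apply: eq_tsum => m0 m1; apply: eq_tsum => n0 n1; rewrite tsum_tens.
Qed.
End Tensor.

Section FreeModule.
Variables (A : comodule_algebra H) (M : comodule H).

Definition free_act (a : A) (t : tensor A M) : tensor A M :=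
  \tsum_(b, m <- t) amul a b ⊗ m.

Let amul_bl : is_bilinear (@amul k A) := amul_bilinear A.

Let free_act_bilinear_at a : is_bilinear (fun (b : A) (m : M) => amul a b ⊗ m).
Proof.
by have [_ r] := amul_bl; apply: (@bilinear_tens _ _ _ _ _ _ id) => //;
  exact: r.
Qed.

Lemma free_act_tens a b m : free_act a (b ⊗ m) = amul a b ⊗ m.
Proof. exact: (tsum_tens _ _ (free_act_bilinear_at a)). Qed.

Lemma free_act_linear a : linear (free_act a).
Proof. exact: (tsum_linear (free_act_bilinear_at a)). Qed.

Lemma free_actP : is_module free_act.
Proof.
have [bl br] := amul_bl.
split=> [|t|a b]; first split=> [t|]; last 1 first.
- apply: tensor_linear_ext => [||c m].
  + exact: free_act_linear.
  + by apply: linear_comp; exact: free_act_linear.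
  + by rewrite !free_act_tens amulA.
- by apply: linear_of_tsum => b m c x y; rewrite bl tensorDl tensorZl.
- exact: free_act_linear.
- move: t; apply: (@tensor_linear_ext _ _ _ _ _ id) => // [|b m].
    exact: free_act_linear.
  by rewrite free_act_tens amul1.
Qed.

Lemma free_act_colinear :
  @colinear2 k H (ca_comod A) (diag_comod (ca_comod A) M)
    (diag_comod (ca_comod A) M) free_act.
Proof.
have [[bl br] [lA _ _]] := (amul_bl, ca_coactP A).
have free_actl t : linear (fun a => free_act a t).
  by apply: linear_of_tsum => b m c x y; rewrite bl tensorDl tensorZl.
have b1 (a0 : A) (a1 : H) : is_bilinear
    (fun (t0 : tensor A M) (t1 : H) => free_act a0 t0 ⊗ (a1 * t1)).
  by apply: bilinear_tens; [exact: free_act_linear | exact: linear_mull].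
move=> a; apply: tensor_linear_ext => [||b m].
- move=> c u v; rewrite free_act_linear; exact: diag_coact_linear.
- apply: linear_of_tsum => a0 a1; move=> c u v.
  by rewrite /= diag_coact_linear (tsum_linear (b1 a0 a1)).
rewrite free_act_tens /= !diag_coact_tens.
transitivity (\tsum_(a0, a1 <- ca_coact a) \tsum_(b0, b1 <- ca_coact b)
  \tsum_(m0, m1 <- coact m) (amul a0 b0 ⊗ m0) ⊗ (a1 * b1 * m1)).
  have bF : is_bilinear (fun (c0 : ca_comod A) (c1 : H) =>
      \tsum_(m0, m1 <- coact m) (c0 ⊗ m0) ⊗ (c1 * m1)).
    by split; multilinear.
  have caM (x y : A) : ca_coact (amul x y) = \tsum_(x0, x1 <- ca_coact x)
      \tsum_(y0, y1 <- ca_coact y) amul x0 y0 ⊗ (x1 * y1) := @ca_mul k H A x y.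
  rewrite /diag_tens /= caM (linear_tsum _ _ (tsum_linear bF)).
  apply: eq_tsum => a0 a1; rewrite (linear_tsum _ _ (tsum_linear bF)).
  by apply: eq_tsum => b0 b1'; rewrite tsum_tens.
apply: eq_tsum => a0 a1; rewrite (@linear_tsum_diag (ca_comod A) M _ _ b m
  (b1 a0 a1)).
by apply: eq_tsum => b0 b1'; apply: eq_tsum => m0 m1;
  rewrite free_act_tens mulrA.
Qed.

Definition free_lmod : comodule_lmod A :=
  @ComoduleLMod k H A (diag_comod (ca_comod A) M) free_act free_actP
    free_act_colinear.

Lemma free_unit_colinear : @colinear k H M free_lmod (fun m => aone A ⊗ m).
Proof.
move=> m; rewrite /= diag_coact_tens /diag_tens /= (@ca_one k H A) tsum_tens.
  by apply: eq_tsum => m0 m1; rewrite mul1r.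
by split; multilinear.
Qed.

Definition free_unit : @phom (Comod H) M (@cl_comod k H A free_lmod) :=
  exist _ (fun m : M => aone A ⊗ m) (conj (linear_tensr (aone A))
    free_unit_colinear).

(** A colinear map g : M -> N extends uniquely to the A-linear map a ⊗ m |-> a
    g(m), which is colinear because the action of A on N is. *)
Lemma free_unit_universal :
  universal_arrow (U := forget_LModComod A) (A := free_lmod) free_unit.
Proof.
move=> N g; have [lg cg] := svalP g.
have [[al ar] a1 aM] := cl_actP N.
pose b (a : A) (m : M) : N := cl_act a (sval g m).
have bb : is_bilinear b.
  by split=> [m|a] c u v; rewrite /b ?al ?lg ?ar.
have cb : @colinear2 k H (ca_comod A) M N b.
  move=> a m; rewrite /b (@cl_act_colinear k H A N) cg;
    apply: eq_tsum => a0 a1'.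
  have bt : is_bilinear (fun (n0 : N) (n1 : H) => cl_act a0 n0 ⊗ (a1' * n1)).
    by apply: bilinear_tens; [exact: ar | exact: linear_mull].
  rewrite (linear_tsum _ _ (tsum_linear bt)); apply: eq_tsum => m0 m1.
  by rewrite tsum_tens.
have lh : linear (tsum b) := tsum_linear bb.
have hh : @cl_linear k H A free_lmod N (tsum b).
  split; first exact: colinear2_tsum.
  move=> a; apply: tensor_linear_ext => [||c m].
  - exact: linear_comp lh (free_act_linear a).
  - exact: linear_comp (ar a) lh.
  - by rewrite /= free_act_tens !tsum_tens // /b aM.
exists (exist _ (tsum b) (conj lh hh)); split.
  by apply: lin_homP => m /=; rewrite tsum_tens // /b a1.
move=> h' h'E; apply: lin_homP; have [lh' [ch' ah']] := svalP h'.
apply: tensor_linear_ext => // a m; rewrite /= tsum_tens //.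
rewrite /b -h'E /= -ah' /= free_act_tens amulr1 //.
Qed.
End FreeModule.

Lemma forget_LModComod_universal_arrows (A : comodule_algebra H) :
  has_universal_arrows (forget_LModComod A).
Proof.
by move=> M; exists (free_lmod A M), (free_unit A M);
  exact: free_unit_universal.
Qed.
End Diagonal.

(** * The inclusion functors *)

Section InclusionEquivalence.
Variables (k : fieldType) (H : hopfAlgebra k).

(** Every module over the finite-dimensional dual comes from a comodule with
    the same underlying space; the identity map is the required isomorphism. *)
Lemma incl_equivalence : equivalence (incl H).
Proof.
split=> [X Y g|X Y f g e|Y].
- have [lg hg] := svalP g.
  by exists (exist _ (sval g) (conj lg (hlinear_colinear lg hg)));
    exact: lin_homP.
- apply: lin_homP => x.
  exact: (congr1 (fun h : @phom (HMod H) (incl_obj X) (incl_obj Y) => sval h x)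
    e).
- have lid : linear (@id Y) by [].
  have ha : @hlinear k H (incl_obj (coincl_obj Y)) Y id.
    by move=> x m; rewrite incl_coincl_hact.
  have hb : @hlinear k H Y (incl_obj (coincl_obj Y)) id.
    by move=> x m; rewrite incl_coincl_hact.
  exists (coincl_obj Y), (exist _ id (conj lid ha)), (exist _ id (conj lid hb)).
  by split; exact: lin_homP.
Qed.

Variable A : comodule_algebra H.

Section LModObj.
Variable N : hmodule_lmod (incl_alg A).

Lemma coincl_act_colinear2 :
  @colinear2 k H (ca_comod A) (coincl_obj N) (coincl_obj N)
    (@hl_act k H (incl_alg A) N).
Proof.
apply: hlinear2_colinear2 => [|x a n]; first by have [] := hl_actP N.
rewrite incl_coincl_hact (@hl_act_hlinear k H (incl_alg A) N).
by apply: eq_tsum => y z; rewrite incl_coincl_hact.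
Qed.

Definition coincl_lmod_obj : comodule_lmod A :=
  @ComoduleLMod k H A (coincl_obj N) (@hl_act k H (incl_alg A) N) (hl_actP N)
    coincl_act_colinear2.
End LModObj.

Lemma incl_lmod_equivalence : equivalence (incl_lmod A).
Proof.
split=> [X Y g|X Y f g e|Y].
- have [lg [hg ag]] := svalP g.
  by exists (exist _ (sval g) (conj lg (conj (hlinear_colinear lg hg) ag)));
    exact: lin_homP.
- apply: lin_homP => x.
  exact: (congr1 (fun h : @phom (LModHMod (incl_alg A)) (incl_lmod_obj X)
    (incl_lmod_obj Y)
    => sval h x) e).
- have lid : linear (@id Y) by [].
  have ha : @hl_linear k H (incl_alg A) (incl_lmod_obj (coincl_lmod_obj Y)) Y
    id.
    by split=> // x m; rewrite incl_coincl_hact.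
  have hb : @hl_linear k H (incl_alg A) Y (incl_lmod_obj (coincl_lmod_obj Y))
    id.
    by split=> // x m; rewrite incl_coincl_hact.
  exists (coincl_lmod_obj Y), (exist _ id (conj lid ha)),
    (exist _ id (conj lid hb)).
  by split; exact: lin_homP.
Qed.

(** The functors share their object part definitionally, so that an equality of
    their values on maps can be stated without transport. *)
Lemma functor_eq (C D : category) (F0 : obj C -> obj D)
    (F1 G1 : forall X Y, hom X Y -> hom (F0 X) (F0 Y)) F11 F1M G11 G1M :
  (forall X Y (f : hom X Y), F1 _ _ f = G1 _ _ f) ->
  @Functor C D F0 F1 F11 F1M = @Functor C D F0 G1 G11 G1M.
Proof.
move=> e; have e1 : F1 = G1.
  by apply: functional_extensionality_dep => X;
    apply: functional_extensionality_dep => Y; apply: funext => f.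
by rewrite -e1 in G11 G1M *; congr Functor; exact: Prop_irrelevance.
Qed.

Lemma forget_incl : functor_comp (forget_LModHMod (incl_alg A)) (incl_lmod A) =
  functor_comp (incl H) (forget_LModComod A).
Proof. by apply: functor_eq => X Y f; exact: lin_homP. Qed.

End InclusionEquivalence.

Theorem corollary1p2 (k : fieldType) (H : hopfAlgebra k)
    (H_comm : commutative (@GRing.mul H)) (H_cofrob : cofrobenius H)
    (A : comodule_algebra H) :
  let i := incl H in
  let i_A := incl_lmod A in
  let U := forget_LModComod A in
  let U' := forget_LModHMod (incl_alg A) in
  let M := stable_model (Comod H) in
  let M' := stable_model (HMod H) in
  let M_A := right_induced M U in
  let M'_A := right_induced M' U' in
  [/\ functor_comp U' i_A = functor_comp i U,
      is_model_structure M,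
      is_model_structure M'
    & is_model_structure M'_A ->
      [/\ is_model_structure M_A,
          left_quillen M M' i /\ right_quillen M M' i,
          left_quillen M_A M'_A i_A /\ right_quillen M_A M'_A i_A,
          right_quillen M_A M U
        & right_quillen M'_A M' U']].
Proof.
move=> i i_A U U' M M' M_A M'_A.
have eq_i : equivalence i := incl_equivalence H.
have eq_iA : equivalence i_A := incl_lmod_equivalence A.
have same_i : same_classes i M M'.
  by apply: stable_same_classes => // X Y f g; exact: lin_homP.
have modM' : is_model_structure M' :=
  frobenius_stable_model (hmod_frobenius H_cofrob).
have UE (X Y : obj (LModComod A)) (f : hom X Y) :
    fmap U' (fmap i_A f) = fmap i (fmap U f) by exact: lin_homP.
split=> //; first exact: forget_incl.
  exact: (transport_model eq_i same_i modM').
move=> modM'A.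
have same_iA : same_classes i_A M_A M'_A.
  have [_ _ [rw _ rf] _ _ _ _] := modM'A.
  apply: right_induced_same_classes => // X Y f.
    by rewrite UE; exact: (same_weq same_i).
  by rewrite UE; exact: (same_fib same_i).
have uaU : has_universal_arrows U := @forget_LModComod_universal_arrows k H A.
split.
- exact: (transport_model eq_iA same_iA modM'A).
- by split; [exact: equivalence_left_quillen | exact: equivalence_right_quillen].
- by split; [exact: equivalence_left_quillen | exact: equivalence_right_quillen].
- by split=> //; exact: left_adjoint_of_universal_arrows.
- split=> //; apply: left_adjoint_of_universal_arrows.
  (* Up to the equivalence i_A, U' is i U, a composite of right adjoints. *)
  apply: (universal_arrows_cancel eq_iA); rewrite forget_incl.
  by apply: universal_arrows_comp uaU; exact: equivalence_universal_arrows.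
Qed.
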